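(* Consider the Retrospective Approximation (RA) algorithm described in the context. Suppose that, for a constant $C<\infty$ and every $k\ge1$, the solver, when executed on the problem of minimizing $f_{M_k}$ starting at $X_{k-1}$, is $(\tfrac12,C_{M_k})$-sublinearly convergent, i.e. its inner iterates satisfy, for $t\ge1$, $$\|\nabla f_{M_k}(X_{k-1,t})\|\le C_{M_k}\left(f_{M_k}(X_{k-1})-f_{M_k}(X_{k-1,t})\right)^{1/2}t^{-1/2}\le C_{M_k}\left(f_{M_k}(X_{k-1})-\inf_{x\in\mathbb{R}^d}f_{M_k}(x)\right)^{1/2}t^{-1/2},$$ where $0<C_{M_k}\le C$. Let $M_1=m_1$ and $$M_k=c_1M_{k-1}\ (k\ge2),\quad 1<c_1<\infty;\qquad \epsilon_k=\frac{C_{2,k}}{\sqrt{M_k}},\quad C_{2,k}\in[\underline c_2,c_2],\quad 0<\underline c_2\le c_2<\infty,$$ where $C_{2,k}$ is $\mathcal{F}_{k-1}$-measurable and $c_1,\underline c_2,c_2$ are non-random constants. Suppose there exists $C_A<\infty$ such that $$\sup_k\mathbb{E}[f(X_k)]<\frac{C_A}2,\qquad \mathbb{E}\left[\inf_{x\in\mathbb{R}^d}F(x,Y)\right]>-\frac{C_A}2 .$$ Suppose there is $\sigma<\infty$ with $\mathbb{E}\left[(\sqrt{M_k}\,G_{M_k})^2\mid\mathcal{F}_{k-1}\right]\le\sigma^2$ for all $k\ge1$. Suppose further that one of the following holds. (I) $\sup_{x\in\mathbb{R}^d}\|R_m(x)\|\to0$ almost surely as $m\to\infty$, $\mathbb{E}[G^2(Y)]<\infty$,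 and $\sup_k\mathbb{E}[\|\nabla f(X_k)\|^2\mid\mathcal{F}_{k-1}]\le\ell_{2,\infty}^2$ for a constant $\ell_{2,\infty}<\infty$. In this case set $$A:=\frac{\sqrt{c_1}\,(c_2+c_0\sigma+\sigma\ell_{2,\infty})}{\sqrt{m_1}}.$$ (II) For some $\alpha\in(0,1)$, $\delta_0>0$ and $\sigma_0<\infty$, $\mathbb{E}\left[(\sqrt{M_k}\,H_{M_k})^{1/\alpha}\mid\mathcal{F}_{k-1}\right]\le\sigma_0^{1/\alpha}$ for all $k$, where $H_m:=\sup_{x\in\mathbb{R}^d}\|R_m(x)\|(\|\nabla f(x)\|^\alpha+\delta_0)$. In this case set $$A:=\sqrt{c_1}\left(\frac{2(c_2+c_0\sigma_0/\delta_0)}{\sqrt{m_1}}\right)+\left(\frac{\kappa_2}{\sqrt{m_1}}\right)^{1/\alpha},\qquad \kappa_2:=2(1-\alpha)\left(\frac{2\alpha}{1-\alpha}\right)^{\alpha}\sigma_0 .$$ Then an expected number of oracle calls of order $\frac{A^4m_1CC_A}{(c_1^2-1)\underline c_2^2\epsilon^4}$ suffices for RA to reach expected gradient norm at most $\epsilon$: for each sufficiently small $\epsilon>0$ there is an outer iteration $k=k(\epsilon)\ge1$ such that $\mathbb{E}\left[\|\nabla f(X_k)\|\right]\le\epsilon$ and $$\mathbb{E}[W_k]=O\left(\frac{A^4\,m_1\,C\,C_A}{(c_1^2-1)\,\underline c_2^{2}\,\epsilon^4}\right)\quad\text{as }\epsilon\to0,$$ where the implied constant does not depend on $\epsilon$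.
   Context: Problem: minimize $f(x):=\mathbb{E}[F(x,Y)]$ over $x\in\mathbb{R}^d$, where $Y$ is a random variable with distribution $P$ on a measurable space $(\mathcal{Y},\mathcal{A})$, $F(\cdot,y)$ is a smooth function on $\mathbb{R}^d$ for every $y\in\mathcal{Y}$ with gradient $\nabla F(\cdot,y)$, and $\mathbb{E}[\nabla F(x,Y)]=\nabla f(x)$ for all $x$. $\|\cdot\|$ is the Euclidean norm. Sampling: $\{\tilde Y_j, j\ge1\}$ is an IID sequence of copies of $Y$. $M_1=m_1$ is a constant positive integer, $\mathcal{F}_0$ is trivial, $\mathcal{F}_k:=\sigma(\tilde Y_j: j\le \sum_{i=1}^k M_i)$, and the (positive-integer-valued) sample size $M_{k+1}$ is $\mathcal{F}_k$-measurable. At iteration $k$ the sample-path function and gradient are $$f_{M_k}(x):=\frac1{M_k}\sum_{j=1}^{M_k}F(x,Y_j),\qquad \nabla f_{M_k}(x):=\frac1{M_k}\sum_{j=1}^{M_k}\nabla F(x,Y_j),\qquad Y_j:=\tilde Y_{(\sum_{i=1}^{k-1}M_i)+j}.$$ RA algorithm: start from a (deterministic) initial guess $X_0$. At each outer iteration $k\ge1$, with $\mathcal{F}_{k-1}$-measurable $M_k$ and tolerance $\epsilon_k$, run an iterative deterministic solver on the problem of minimizing $f_{M_k}$ over $\mathbb{R}^d$ from $X_{k-1,0}:=X_{k-1}$, producing inner iterates $X_{k-1,t}$, $t=0,1,2,\dots$; let $N_k:=\min\{t:\|\nabla f_{M_k}(X_{k-1,t})\|\le\epsilon_k\}$ and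 set $X_k:=X_{k-1,N_k}$. The total number of oracle calls after $k$ outer iterations is $W_k:=\sum_{j=1}^kN_jM_j$. Relative error: fix $c_0>0$. $R(x,Y):=\frac{\nabla F(x,Y)-\nabla f(x)}{\|\nabla f(x)\|+c_0}$, with envelope $G(Y):=\sup_{x\in\mathbb{R}^d}\|R(x,Y)\|$. For $m\ge1$, $R_m(x):=\frac{\nabla f_m(x)-\nabla f(x)}{\|\nabla f(x)\|+c_0}$ with $\nabla f_m(x)=\frac1m\sum_{j=1}^m\nabla F(x,Y_j)$ and $Y_1,Y_2,\dots$ IID copies of $Y$; $G_m:=\sup_{x\in\mathbb{R}^d}\|R_m(x)\|$. $R_{M_k},G_{M_k},H_{M_k}$ denote these quantities formed with $\nabla f_{M_k}$, i.e. with the iteration-$k$ sample. *)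

(* Defs.v *)
From HB Require Import structures.
From mathcomp Require Import all_boot all_order all_algebra.
From mathcomp Require Import all_classical all_reals all_analysis.
From mathcomp Require Import measurable_realfun.

Set Implicit Arguments.
Unset Strict Implicit.
Unset Printing Implicit Defensive.

Import Order.TTheory GRing.Theory Num.Theory.
Import numFieldNormedType.Exports.

Local Open Scope classical_set_scope.
Local Open Scope ring_scope.

(* The library norm on matrices is the sup norm; it induces the same topology
   and the same notion of differentiability as the Euclidean norm. *)
Definition enorm (R : realType) (d : nat) (v : 'rV[R]_d) : R :=
  Num.sqrt (\sum_(i < d) v ord0 i ^+ 2).

(* This vector of partial derivatives is used below only for functions that
   are assumed to be differentiable. *)
Definition grad (R : realType) (d : nat) (h : 'rV[R]_d -> R) (x : 'rV[R]_d) :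
    'rV[R]_d :=
  \row_(i < d) 'D_(delta_mx ord0 i) h x.

(* Continuous differentiability is the sense given to "smooth". *)
Definition smooth (R : realType) (d : nat) (h : 'rV[R]_d -> R) : Prop :=
  (forall x, differentiable h x) /\ continuous (grad h).

Definition iid (R : realType) (dO dY : measure_display)
    (Omega : measurableType dO) (Y : measurableType dY)
    (P : probability Omega R) (mu : probability Y R)
    (Yt : nat -> Omega -> Y) : Prop :=
  [/\ forall j, measurable_fun setT (Yt j),
      forall j (A : set Y), measurable A -> P (Yt j @^-1` A) = mu A
    & forall (s : seq nat) (A : nat -> set Y),
        uniq s -> (forall j, measurable (A j)) ->
        P (\bigcap_(j in [set` s]) (Yt j @^-1` A j))
        = (\prod_(j <- s) P (Yt j @^-1` A j))%E].

(* The sigma-algebra generated by the n variables Yt 0, ..., Yt n.-1; it is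
   trivial for n = 0. *)
Definition sigma_first (dO dY : measure_display)
    (Omega : measurableType dO) (Y : measurableType dY)
    (Yt : nat -> Omega -> Y) (n : nat) : set (set Omega) :=
  <<s [set B | exists j, (j < n)%N /\
         exists A : set Y, measurable A /\ B = Yt j @^-1` A] >>.

(* Measurability of a function with respect to a family G of events, which need
   not be the full sigma-algebra of the domain. *)
Definition measurable_wrt (Omega : Type) (dU : measure_display)
    (U : measurableType dU) (G : set (set Omega)) (g : Omega -> U) : Prop :=
  forall B : set U, measurable B -> G (g @^-1` B).

(* Z is a version of the conditional expectation of the nonnegative random
   variable X given the sigma-algebra G. *)
Definition is_cond_exp (R : realType) (dO : measure_display)
    (Omega : measurableType dO) (P : probability Omega R)
    (G : set (set Omega)) (X Z : Omega -> \bar R) : Prop :=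
  [/\ measurable_fun setT X /\ (forall w, 0 <= X w)%E,
      measurable_wrt G Z /\ (forall w, 0 <= Z w)%E
    & forall B, G B -> (\int[P]_(w in B) Z w = \int[P]_(w in B) X w)%E].

Definition cond_exp_le (R : realType) (dO : measure_display)
    (Omega : measurableType dO) (P : probability Omega R)
    (G : set (set Omega)) (X : Omega -> \bar R) (c : R) : Prop :=
  exists Z, is_cond_exp P G X Z /\ {ae P, forall w, (Z w <= c%:E)%E}.

Definition objective (R : realType) (d : nat) (dY : measure_display)
    (Y : measurableType dY) (mu : probability Y R)
    (F : 'rV[R]_d -> Y -> R) (x : 'rV[R]_d) : R :=
  Rintegral mu setT (F x).

Definition sample_fun (R : realType) (d : nat) (Y : Type)
    (F : 'rV[R]_d -> Y -> R) (m : nat) (s : nat -> Y) (x : 'rV[R]_d) : R :=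
  m%:R^-1 * \sum_(j < m) F x (s j).

Definition sample_grad (R : realType) (d : nat) (Y : Type)
    (F : 'rV[R]_d -> Y -> R) (m : nat) (s : nat -> Y) (x : 'rV[R]_d) :
    'rV[R]_d :=
  m%:R^-1 *: \sum_(j < m) grad (F^~ (s j)) x.

(* Number of observations used up to outer iteration k.  Outer iterations are
   numbered from 1 (M 0 is never used), and observations from 0. *)
Definition nobs (M : nat -> nat) (k : nat) : nat := (\sum_(1 <= i < k.+1) M i)%N.

(* The observations of outer iteration k are the first M k terms of
   [batch M s k]. *)
Definition batch (Y : Type) (M : nat -> nat) (s : nat -> Y) (k j : nat) : Y :=
  s (nobs M k.-1 + j)%N.

Definition first_time (p : nat -> bool) : option nat :=
  match pselect (exists t, p t) with
  | left h => Some (ex_minn h)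
  | right _ => None
  end.

(* A deterministic solver, possibly depending on the outer iteration, sends an
   objective function and a starting point to a sequence of iterates. *)
Definition solver_type (R : realType) (d : nat) : Type :=
  nat -> ('rV[R]_d -> R) -> 'rV[R]_d -> nat -> 'rV[R]_d.

Definition ra_inner (R : realType) (d : nat) (Y : Type)
    (F : 'rV[R]_d -> Y -> R) (S : solver_type R d) (M : nat -> nat)
    (s : nat -> Y) (k : nat) (x : 'rV[R]_d) : nat -> 'rV[R]_d :=
  S k (sample_fun F (M k) (batch M s k)) x.

Definition ra_stop (R : realType) (d : nat) (Y : Type)
    (F : 'rV[R]_d -> Y -> R) (S : solver_type R d) (M : nat -> nat)
    (eps : nat -> R) (s : nat -> Y) (k : nat) (x : 'rV[R]_d) : option nat :=
  first_time (fun t =>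
    enorm (sample_grad F (M k) (batch M s k) (ra_inner F S M s k x t))
      <= eps k).

(* Outer iterates along one sample path s with tolerances eps.  Leaving the
   iterate unchanged when the tolerance is never met is a mere convention:
   sublinear convergence excludes this unless the sample-path function is
   unbounded below. *)
Fixpoint ra_iter (R : realType) (d : nat) (Y : Type)
    (F : 'rV[R]_d -> Y -> R) (S : solver_type R d) (M : nat -> nat)
    (eps : nat -> R) (x0 : 'rV[R]_d) (s : nat -> Y) (k : nat) : 'rV[R]_d :=
  if k is k'.+1 then
    let x := ra_iter F S M eps x0 s k' in
    if ra_stop F S M eps s k x is Some t then ra_inner F S M s k x t else x
  else x0.

(* \bar R-valued: a solver that never meets the tolerance costs +oo, so that it
   cannot make the expected work look smaller. *)
Definition ra_steps (R : realType) (d : nat) (Y : Type)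
    (F : 'rV[R]_d -> Y -> R) (S : solver_type R d) (M : nat -> nat)
    (eps : nat -> R) (x0 : 'rV[R]_d) (s : nat -> Y) (k : nat) : \bar R :=
  if ra_stop F S M eps s k (ra_iter F S M eps x0 s k.-1) is Some t
  then t%:R%:E else +oo%E.

Definition ra_work (R : realType) (d : nat) (Y : Type)
    (F : 'rV[R]_d -> Y -> R) (S : solver_type R d) (M : nat -> nat)
    (eps : nat -> R) (x0 : 'rV[R]_d) (s : nat -> Y) (k : nat) : \bar R :=
  (\sum_(1 <= j < k.+1) ra_steps F S M eps x0 s j * (M j)%:R%:E)%E.

(* (1/2, C)-sublinear convergence of the iterates x on a function h with
   gradient gh.  The first conjunct is the nonnegativity that the square root
   presupposes (Num.sqrt is 0 on negative numbers).  The last bound is in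
   \bar R because h may be unbounded below. *)
Definition sublinear_half (R : realType) (d : nat) (h : 'rV[R]_d -> R)
    (gh : 'rV[R]_d -> 'rV[R]_d) (x : nat -> 'rV[R]_d) (C : R) : Prop :=
  forall t : nat, (1 <= t)%N ->
    let b := C * Num.sqrt (h (x 0%N) - h (x t)) * (Num.sqrt t%:R)^-1 in
    [/\ h (x t) <= h (x 0%N),
        enorm (gh (x t)) <= b
      & (b%:E <= C%:E
           * sqrte ((h (x 0%N))%:E - ereal_inf (range (fun z => (h z)%:E)))
           * ((Num.sqrt t%:R)^-1)%:E)%E].

(* Error of the gradient estimate g of gf, relative to |gf| + c0. *)
Definition rel_err (R : realType) (d : nat) (gf : 'rV[R]_d -> 'rV[R]_d)
    (c0 : R) (g : 'rV[R]_d -> 'rV[R]_d) (x : 'rV[R]_d) : 'rV[R]_d :=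
  (enorm (gf x) + c0)^-1 *: (g x - gf x).

Definition sup_err (R : realType) (d : nat) (gf : 'rV[R]_d -> 'rV[R]_d)
    (c0 : R) (g : 'rV[R]_d -> 'rV[R]_d) : \bar R :=
  ereal_sup (range (fun x => (enorm (rel_err gf c0 g x))%:E)).

Definition sup_err_pow (R : realType) (d : nat) (gf : 'rV[R]_d -> 'rV[R]_d)
    (c0 alpha delta0 : R) (g : 'rV[R]_d -> 'rV[R]_d) : \bar R :=
  ereal_sup (range (fun x =>
    (enorm (rel_err gf c0 g x) * (enorm (gf x) `^ alpha + delta0))%:E)).

(* Main.v *)
Require Import Defs.
From HB Require Import structures.
From mathcomp Require Import all_boot all_order all_algebra.
From mathcomp Require Import all_classical all_reals all_analysis.
From mathcomp Require Import measurable_realfun.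
From mathcomp Require Import ring lra.

Set Implicit Arguments.
Unset Strict Implicit.
Unset Printing Implicit Defensive.

Import Order.TTheory GRing.Theory Num.Theory.
Import numFieldNormedType.Exports.

Local Open Scope classical_set_scope.
Local Open Scope ring_scope.

(** The implied constant may depend on everything but the accuracy e, so the
theorem follows from two facts on the outer iterates X_k: the mean work up to k
is at most a constant times M_k ^ 2, and the mean of |grad f (X_k)| is at most a
constant B divided by sqrt M_k.  As the sample sizes grow geometrically, some
M_k lies between (B / e) ^ 2 and c1 * (B / e) ^ 2; at this k the mean gradient
norm is at most e and the mean work is of order e ^ (-4) ([complexity]).  The
implied constant then absorbs A, C and C_A, which are positive.

Work.  Before it stops at iteration k, the solver satisfies
eps_k < C (f_Mk(X_{k-1}) - inf f_Mk) ^ (1/2) t ^ (-1/2), so it makes at most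
1 + C^2 / eps_k^2 * (f_Mk(X_{k-1}) - inf f_Mk) steps ([sublinear_stop]), and
1 / eps_k^2 is of order M_k.  The infimum of the sample mean is at least the
sample mean of J(Y) = inf_x F(x, Y), and J is integrable
([real_lower_envelope]).  Hence the number of steps is controlled by M_k times
the sample mean of the gaps F(X_{k-1}, Y_j) - J(Y_j) ([stop_ae]).  The observations of batch k are
independent of the past, which determines X_{k-1}; so this sample mean has
expectation at most E[f(X_{k-1})] - E[J], which is bounded in k
([gap_obs_int]).  Summing M_j * M_j over j <= k is a geometric sum dominated by
its last term ([work_int]).

Accuracy.  At X_k the sample gradient has norm at most c2 / sqrt M_k, and the
definition of the relative error rho gives
sqrt M_k z <= c2 + sqrt M_k rho (z + c0), with z = |grad f (X_k)|
([grad_ae]).  In case (I), Young's inequality bounds the right-hand side by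
squares whose means are controlled by hypothesis ([young_bound_sqr]).  In case
(II), either rho <= 1/2 and the term in z is absorbed, or rho > 1/2 and then
the bound on rho z ^ alpha bounds z itself ([young_bound_pow]).

Measurability.  The iterates are known to be measurable only coordinate
by coordinate, and F(x, y) is continuous in x and measurable in y.  Both the
measurability of compositions such as F(X_k, Y_j)
([measurable_caratheodory]) and the independence argument
([integral_indep_comp_le]) replace the random point by a nearby rational
point, which takes countably many values. *)

(** * Random indices with countably many values *)

Lemma first_time_Some (p : nat -> bool) t : first_time p = Some t -> p t.
Proof.
rewrite /first_time; case: pselect => // h [<-].
by case: ex_minnP.
Qed.

Lemma first_time_min (p : nat -> bool) t s :
  first_time p = Some t -> (s < t)%N -> ~~ p s.
Proof.
rewrite /first_time; case: pselect => // h [<-].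
case: ex_minnP => m _ + ltsm => /(_ s) mle.
by apply: contraTN ltsm; rewrite -leqNgt.
Qed.

Lemma first_time_None (p : nat -> bool) t : first_time p = None -> ~~ p t.
Proof.
rewrite /first_time; case: pselect => // h _; apply/negP => pt.
by apply: h; exists t.
Qed.

(** The index N splits the space into countably many measurable pieces, on each
of which the composite agrees with one of the measurable functions h i. *)
Lemma measurable_glue d1 d2 (T : measurableType d1) (U : measurableType d2)
    (I : countType) (N : T -> I) (h : I -> T -> U) :
    (forall i, measurable (N @^-1` [set i])) ->
    (forall i, measurable_fun setT (h i)) ->
  measurable_fun setT (fun w => h (N w) w).
Proof.
move=> mN mh _ B mB; rewrite setTI.
rewrite (_ : _ @^-1` B = \bigcup_i (N @^-1` [set i] `&` h i @^-1` B)).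
  apply: countable_bigcupT_measurable => // i; apply: measurableI => //.
  by rewrite -[X in measurable X]setTI; exact: mh.
apply/seteqP; split => [w /= Bw|w [i _ [/= <-]]//].
by exists (N w).
Qed.

Lemma measurable_first_time d1 (T : measurableType d1) (p : T -> nat -> bool) :
    (forall t, measurable_fun setT (fun w => p w t)) ->
  forall o, measurable ((fun w => first_time (p w)) @^-1` [set o]).
Proof.
move=> mp; have mS t b : measurable [set w | p w t = b].
  by have := mp t measurableT [set b] I; rewrite setTI.
have mSome t : measurable ((fun w => first_time (p w)) @^-1` [set Some t]).
  rewrite (_ : _ @^-1` _ = [set w | p w t = true] `&`
      \bigcap_(s < t) [set w | p w s = false]).
    apply: measurableI => //; apply: bigcap_measurableType => s _; exact: mS.
  apply/seteqP; split=> w /= => [e|[pt ps]].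
    split; first exact: first_time_Some e.
    by move=> s /= st; apply/negbTE/(first_time_min e st).
  case e: (first_time (p w)) => [s|]; last first.
    by have := first_time_None t e; rewrite pt.
  congr Some; apply/eqP; rewrite eqn_leq.
  apply/andP; split; rewrite leqNgt; apply/negP.
    by move=> /(first_time_min e); rewrite pt.
  by move=> /ps /=; rewrite (first_time_Some e).
case=> [t|]; first exact: mSome.
rewrite (_ : _ @^-1` _ = \bigcap_t [set w | p w t = false]).
  by apply: bigcapT_measurable => t; exact: mS.
apply/seteqP; split=> w /= => [e t _ /=|pF].
  exact/negbTE/first_time_None.
case e: (first_time (p w)) => [s|//].
by have := first_time_Some e; rewrite (pF s).
Qed.

Lemma measurable_forall d1 (T : measurableType d1) (I : finType)
    (p : I -> T -> bool) :
    (forall i, measurable_fun setT (p i)) ->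
  measurable_fun setT (fun w => [forall i, p i w]).
Proof.
move=> mp.
rewrite (_ : (fun _ => _) = (fun w => all (p^~ w) (enum I))).
  by elim: (enum I) => [|i s ih]; [exact: measurable_cst|exact: measurable_and].
apply/funext => w; apply/forallP/allP => [pw i _|pw i]; first exact: pw.
by apply: pw; rewrite mem_enum.
Qed.

(** * Functions that are continuous in a point and measurable in the outcome *)

(** An enumeration of the points with rational coordinates.  The argument is an
option so that an index returned by a search can be used directly. *)
Definition rat_point (R : realType) (d : nat) (o : option nat) : 'rV[R]_d :=
  if o is Some i then
    if unpickle i is Some v then map_mx ratr (v : 'rV[rat]_d) else 0
  else 0.
Arguments rat_point {R d}.

(** Controlling the values of h along with the point keeps the integral of h along
an approximation of X close to that of h along X, without any domination. *)
Definition near_point (R : realType) (d : nat) (h : 'rV[R]_d -> R)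
    (n : nat) (x : 'rV[R]_d) (i : nat) : bool :=
  [forall j, `|x ord0 j - rat_point (Some i) ord0 j| < n.+1%:R^-1] &&
  (`|h x - h (rat_point (Some i))| < n.+1%:R^-1).

Definition approx_index (R : realType) (d : nat) (h : 'rV[R]_d -> R)
    (n : nat) (x : 'rV[R]_d) : option nat :=
  first_time (near_point h n x).

Lemma rat_point_dense (R : realType) (d : nat) (x : 'rV[R]_d) (e : R) : 0 < e ->
  exists i, ball x e (rat_point (Some i)).
Proof.
move=> e0.
have /choice[v vP] : forall j : 'I_d, exists q : rat, ball (x ord0 j) e (ratr q).
  move=> j; have /rat_in_itvoo[q] : x ord0 j - e < x ord0 j + e by lra.
  rewrite in_itv /= => /andP[q1 q2]; exists q.
  by rewrite /ball /= ltr_norml; lra.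
exists (pickle (\row_j v j : 'rV[rat]_d)); split => // i j.
by rewrite /rat_point pickleK !mxE ord1; exact: vP.
Qed.

Section approx.
Context (R : realType) (d : nat) (h : 'rV[R]_d -> R).
Hypothesis ch : continuous h.

Lemma approx_indexP n x :
  let q := rat_point (approx_index h n x) in
  ball x n.+1%:R^-1 q /\ `|h x - h q| < n.+1%:R^-1.
Proof.
rewrite /approx_index /=.
case e: first_time => [i|].
  have /andP[/forallP xi hi] := first_time_Some e; split=> //.
  by split=> // k j; rewrite ord1; exact: xi.
have /nbhs_ballP[r /= r0 hr] : nbhs x [set y | `|h x - h y| < n.+1%:R^-1].
  by have /cvgrPdist_lt/(_ n.+1%:R^-1) := @ch x; apply.
have rn0 : 0 < Num.min r n.+1%:R^-1 by rewrite lt_min r0 invr_gt0 ltr0n.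
have [i [_ xi]] := rat_point_dense x rn0.
exfalso; have /negP := first_time_None i e; apply.
rewrite /near_point; apply/andP; split.
  apply/forallP => j; apply: lt_le_trans (xi ord0 j) _.
  by rewrite ge_min lexx orbT.
apply: hr; split=> // k j; apply: lt_le_trans (xi k j) _.
by rewrite ge_min lexx.
Qed.

Lemma cvg_rat_approx x : (fun n => rat_point (approx_index h n x)) @ \oo --> x.
Proof.
apply/cvg_ballP => e e0.
apply: filterS (cvgr_lt 0 (@cvg_harmonic R) e e0) => n /= /ltW ne.
by have [xn _] := approx_indexP n x; exact: le_ball xn.
Qed.

End approx.

Section caratheodory.
Context (R : realType) (d : nat) (d1 : measure_display) (T : measurableType d1).
Variable X : T -> 'rV[R]_d.
Hypothesis mX : forall i, measurable_fun setT (fun w => X w ord0 i).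

Lemma measurable_approx_index (h : 'rV[R]_d -> R) n o :
  measurable_fun setT (h \o X) ->
  measurable ((fun w => approx_index h n (X w)) @^-1` [set o]).
Proof.
move=> mh; apply: measurable_first_time => i.
apply: measurable_and; last first.
  apply: measurable_fun_ltr; last exact: measurable_cst.
  by apply: measurableT_comp => //; exact: measurable_funB.
apply: measurable_forall => j.
apply: measurable_fun_ltr; last exact: measurable_cst.
apply: measurableT_comp => //; exact: measurable_funB.
Qed.

(** The rational approximations of X have countably many values, so Phi along
them is measurable by gluing; continuity passes this to the limit. *)
Lemma measurable_caratheodory (Phi : 'rV[R]_d -> T -> R) :
    (forall w, continuous (Phi^~ w)) ->
    (forall x, measurable_fun setT (Phi x)) ->
  measurable_fun setT (fun w => Phi (X w) w).
Proof.
move=> cPhi mPhi; pose h := cst 0 : 'rV[R]_d -> R.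
have ch : continuous h by exact: cst_continuous.
apply: (@measurable_fun_cvg _ _ _ _
    (fun n w => Phi (rat_point (approx_index h n (X w))) w)) => [n|w _].
  apply: (@measurable_glue _ _ _ _ _ (fun w => approx_index h n (X w))
    (fun o w => Phi (rat_point o) w)) => // o.
  by apply: measurable_approx_index; exact: measurable_cst.
apply: (@continuous_cvg _ _ _ \oo _ _ (Phi^~ w) (X w)); first exact: cPhi.
exact: cvg_rat_approx.
Qed.

Lemma measurable_continuous_comp (h : 'rV[R]_d -> R) :
  continuous h -> measurable_fun setT (h \o X).
Proof.
move=> ch; apply: (@measurable_caratheodory (fun x _ => h x)) => x //.
Qed.

End caratheodory.

(** A derivative need not be continuous, but it is the limit of the difference
quotients of h, and these are continuous. *)
Lemma measurable_partial (R : realType) (d : nat) d1 (T : measurableType d1)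
    (X : T -> 'rV[R]_d) (h : 'rV[R]_d -> R) (v : 'rV[R]_d) :
    (forall i, measurable_fun setT (fun w => X w ord0 i)) ->
    (forall x, differentiable h x) ->
  measurable_fun setT (fun w => 'D_v h (X w)).
Proof.
move=> mX dh.
have ch : continuous h by move=> x; exact: differentiable_continuous.
pose s (n : nat) : R := n.+1%:R^-1.
have s0 n : s n != 0 by rewrite invr_neq0 ?pnatr_eq0.
apply: (@measurable_fun_cvg _ _ _ _
  (fun n w => (s n)^-1 * (h (s n *: v + X w) - h (X w)))) => [n|w _].
  apply: measurable_funM; first exact: measurable_cst.
  apply: measurable_funB; last exact: measurable_continuous_comp.
  apply: (measurable_continuous_comp mX
    (h := fun x => h (s n *: v + x))) => x.
  apply: (@continuous_comp _ _ _ (fun x => s n *: v + x) h); last exact: ch.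
  apply: (@continuousD _ _ _ (cst (s n *: v)) id x); last exact: cvg_id.
  exact: cst_continuous.
have dX : derivable h (X w) v by exact: diff_derivable.
have /cvgr_dnbhsP/(_ s) := dX; apply; split => //.
exact: cvg_harmonic.
Qed.

(** * Independence of an observation from the past *)

Section past.
Context (R : realType) (dO dY : measure_display)
  (Omega : measurableType dO) (Y : measurableType dY)
  (P : probability Omega R) (mu : probability Y R) (Yt : nat -> Omega -> Y).

Definition past_events (n : nat) : set (set Omega) :=
  [set B | exists j, (j < n)%N /\
     exists A : set Y, measurable A /\ B = Yt j @^-1` A].

Definition past_type (n : nat) := g_sigma_algebraType (past_events n).

(** Measurability with respect to the first n observations is ordinary
measurability on a copy of the space that carries the smaller sigma-algebra;
all closure properties of measurable functions thus apply to it. *)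
Lemma measurable_wrtP (dU : measure_display) (U : measurableType dU) n
    (g : Omega -> U) :
  measurable_wrt (sigma_first Yt n) g <->
  measurable_fun [set: past_type n] (g : past_type n -> U).
Proof.
split=> [mg _ B mB|mg B mB]; first by rewrite setTI; exact: mg.
by have := mg measurableT B mB; rewrite setTI.
Qed.

Lemma sub_sigma_first n m :
  (n <= m)%N -> sigma_first Yt n `<=` sigma_first Yt m.
Proof.
move=> nm; apply: smallest_sub; first exact: smallest_sigma_algebra.
move=> B [j [jn AB]]; apply: sub_sigma_algebra.
by exists j; split=> //; exact: (leq_trans jn).
Qed.

Lemma sub_measurable_wrt (dU : measure_display) (U : measurableType dU) n m
    (g : Omega -> U) : (n <= m)%N ->
  measurable_wrt (sigma_first Yt n) g -> measurable_wrt (sigma_first Yt m) g.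
Proof. by move=> nm mg B mB; apply: (sub_sigma_first nm); exact: mg. Qed.

Lemma measurable_wrt_obs n j : (j < n)%N ->
  measurable_wrt (sigma_first Yt n) (Yt j).
Proof.
by move=> jn B mB; apply: sub_sigma_algebra; exists j; split=> //; exists B.
Qed.

Hypothesis hY : iid P mu Yt.

Lemma measurable_obs j : measurable_fun setT (Yt j).
Proof. by case: hY. Qed.

Lemma law_obs j (A : set Y) : measurable A -> P (Yt j @^-1` A) = mu A.
Proof. by case: hY => _ + _; exact. Qed.

Lemma sigma_first_measurable n : sigma_first Yt n `<=` measurable.
Proof.
apply: smallest_sub; first exact: sigma_algebra_measurable.
move=> _ [j [_ [A [mA ->]]]].
by rewrite -[X in measurable X]setTI; exact: measurable_obs.
Qed.

Lemma measurable_wrt_fun (dU : measure_display) (U : measurableType dU) n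
    (g : Omega -> U) :
  measurable_wrt (sigma_first Yt n) g -> measurable_fun setT g.
Proof.
by move=> mg _ B mB; rewrite setTI; apply: sigma_first_measurable; exact: mg.
Qed.

Let cylinder n (A : nat -> set Y) : set Omega :=
  \bigcap_(i in [set` iota 0 n]) (Yt i @^-1` A i).

(** The product rule for finitely many observations gives the claim on cylinders
of the first n observations.  These are stable under intersection, and the
events B that satisfy the claim form a lambda-system. *)
Lemma sigma_first_indep n j (B : set Omega) (A : set Y) :
    (n <= j)%N -> sigma_first Yt n B -> measurable A ->
  (P (B `&` Yt j @^-1` A) = P B * mu A)%E.
Proof.
move=> nj + mA.
pose E := Yt j @^-1` A.
have mE : measurable E by rewrite -[E]setTI; exact: measurable_obs.
pose G := [set B | exists2 A : nat -> set Y, forall i, measurable (A i) &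
  B = cylinder n A].
pose D := [set B | measurable B /\ (P (B `&` E) = P B * P E)%E].
have GI : setI_closed G.
  move=> _ _ [A1 mA1 ->] [A2 mA2 ->]; exists (fun i => A1 i `&` A2 i).
    by move=> i; exact: measurableI.
  by rewrite /cylinder -bigcapI.
have sG : sigma_first Yt n `<=` <<s G >>.
  apply: smallest_sub; first exact: smallest_sigma_algebra.
  move=> _ [i [ni [A' [mA' ->]]]]; apply: sub_sigma_algebra.
  (* a single constraint is a cylinder with trivial other factors *)
  exists (fun k => if k == i then A' else setT).
    by move=> k; case: ifP.
  apply/seteqP; split=> w /=.
    by move=> Aw k _; case: eqP => // ->.
  by move/(_ i); rewrite eqxx; apply; rewrite /= mem_iota.
have mG B' : G B' -> measurable B'.
  move=> [A' mA' ->]; apply: bigcap_measurableType => i _.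
  by rewrite -[X in measurable X]setTI; exact: measurable_obs.
have iidE s (A' : nat -> set Y) := let: And3 _ _ h := hY in h s A'.
suff sD : <<s G >> `<=` D.
  by move=> /sG/sD[_]; rewrite /E law_obs.
apply: lambda_system_subset => //.
- apply/dynkin_lambda_system; split.
  + by split=> //; rewrite setTI probability_setT mul1e.
  + move=> B' [mB' PB']; split; first exact: measurableC.
    have -> : (P (~` B' `&` E) = P E - P (B' `&` E))%E.
      rewrite (setIC (~` B')) -setDE measureD// ?(setIC E)//.
      by rewrite ltey_eq fin_num_measure.
    by rewrite PB' probability_setC// muleBl ?mul1e ?fin_num_measure.
  + move=> F tF DF; split.
      by apply: bigcup_measurable => k _; have [] := DF k.
    rewrite setI_bigcupl.
    have mF k : measurable (F k) by have [] := DF k.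
    rewrite !measure_semi_bigcup//; last 4 first.
    * exact: bigcup_measurable.
    * by move=> k; exact: measurableI.
    * exact: trivIset_setIr.
    * by apply: bigcup_measurable => k _; exact: measurableI.
    rewrite muleC -(@fineK _ (P E)) ?fin_num_measure// -nneseriesZl//.
    apply: eq_eseriesr => k _; rewrite fineK ?fin_num_measure// muleC.
    exact: (DF k).2.
- move=> B' GB'; split; first exact: mG.
  case: GB' => A' mA' ->.
  pose A2 k := if k == j then A else A' k.
  have mA2 k : measurable (A2 k) by rewrite /A2; case: ifP.
  have jn : j \notin iota 0 n by rewrite mem_iota add0n -leqNgt nj.
  have A2E k : k \in iota 0 n -> A2 k = A' k.
    by rewrite /A2; case: eqP => // -> jn'; rewrite jn' in jn.
  have -> : cylinder n A' `&` E =
      \bigcap_(i in [set` j :: iota 0 n]) (Yt i @^-1` A2 i).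
    apply/seteqP; split=> w /=.
      move=> [Aw Ew] k /=; rewrite inE => /orP[/eqP ->|kn].
        by rewrite /A2 eqxx.
      by rewrite A2E//; exact: Aw.
    move=> Aw; split; last first.
      by have := Aw j; rewrite /A2 eqxx /= mem_head; apply.
    by move=> k /= kn; rewrite -A2E//; apply: Aw; rewrite /= inE kn orbT.
  rewrite iidE//; last by rewrite /= jn iota_uniq.
  rewrite big_cons {1}/A2 eqxx muleC; congr (_ * _)%E.
  rewrite /cylinder iidE ?iota_uniq// !big_seq.
  by apply: eq_bigr => k kn; rewrite A2E.
Qed.

End past.

(** * Integrals of functions of independent arguments *)

Section indep.
Context (R : realType) (dO dY : measure_display)
  (Omega : measurableType dO) (Y : measurableType dY)
  (P : probability Omega R) (mu : probability Y R).

(** The law of V under the restriction of P to B is P B times mu. *)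
Lemma integral_indep (B : set Omega) (V : Omega -> Y) (g : Y -> R) :
    measurable B -> measurable_fun setT V ->
    (forall A, measurable A -> (P (B `&` V @^-1` A) = P B * mu A)%E) ->
    measurable_fun setT g -> (forall y, 0 <= g y) ->
  (\int[P]_(w in B) (g (V w))%:E = P B * \int[mu]_y (g y)%:E)%E.
Proof.
move=> mB mV indep mg g0.
have mg' : measurable_fun setT (EFin \o g) by exact/measurable_EFinP.
have mgV : measurable_fun setT (EFin \o g \o V) by exact: measurableT_comp.
pose nu := mrestr P mB.
have PB0 : 0 <= fine (P B) by exact/fine_ge0.
have -> : (\int[P]_(w in B) (g (V w))%:E = \int[nu]_w (g (V w))%:E)%E.
  rewrite -(setUv B) ge0_integral_setU//=.
  - rewrite [X in _ = (_ + X)%E]null_set_integral ?adde0.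
    + apply: eq_measure_integral => A mA AB.
      by rewrite /= /nu /mrestr /= setIidl.
    + exact: measurableC.
    + exact: measurable_funTS.
    + by rewrite /= /nu /mrestr /= setICl measure0.
  - exact: measurableC.
  - exact: measurable_funTS.
  - by move=> w _; rewrite lee_fin.
  - by apply/disj_set2P; exact: setICr.
rewrite -(@ge0_integral_pushforward _ _ _ _ _ V mV nu setT (EFin \o g))//.
  rewrite -[in RHS](@fineK _ (P B)) ?fin_num_measure//.
  rewrite -(@ge0_integral_mscale _ _ _ mu _ measurableT (NngNum PB0) (EFin \o g))//.
    apply: eq_measure_integral => A mA _.
    transitivity (P (V @^-1` A `&` B)) => //.
    by rewrite setIC indep// -[in LHS](@fineK _ (P B)) ?fin_num_measure.
  by move=> y _; rewrite lee_fin.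
by move=> y _; rewrite lee_fin.
Qed.

Lemma integral_cst_probability (r : R) : (\int[P]_w r%:E = r%:E)%E.
Proof. by rewrite -[RHS](expectation_cst P r) unlock. Qed.

(** The freezing inequality: an argument X that depends on the past can be
treated as a constant when integrating the independent variable V.  When X has
countably many values this is an equality, by [integral_indep] on each level
set.  In general X is replaced by the rational points chosen for gamma, so that
gamma changes by at most 1 / (n + 1); the left-hand side passes to the limit by
Fatou's lemma, which is why only an inequality is obtained. *)
Lemma integral_indep_comp_le (d : nat) (G : set (set Omega))
    (X : Omega -> 'rV[R]_d) (V : Omega -> Y)
    (g : 'rV[R]_d -> Y -> R) (gamma : 'rV[R]_d -> R) :
    <<s G >> `<=` measurable ->
    (forall i, measurable_fun [set: g_sigma_algebraType G]
       ((fun w => X w ord0 i) : g_sigma_algebraType G -> R)) ->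
    measurable_fun setT V ->
    (forall B A, <<s G >> B -> measurable A ->
       (P (B `&` V @^-1` A) = P B * mu A)%E) ->
    (forall y, continuous (g^~ y)) ->
    (forall x, measurable_fun setT (g x)) ->
    (forall x y, 0 <= g x y) ->
    continuous gamma ->
    (forall x, \int[mu]_y (g x y)%:E = (gamma x)%:E)%E ->
  (\int[P]_w (g (X w) (V w))%:E <= \int[P]_w (gamma (X w))%:E)%E.
Proof.
move=> sG mX mV indep cg mg g0 cgamma intg.
have gamma0 x : 0 <= gamma x.
  by rewrite -lee_fin -intg; apply: integral_ge0 => y _; rewrite lee_fin.
have mXO i : measurable_fun [set: Omega] (fun w => X w ord0 i).
  move=> _ A mA; rewrite setTI.
  by have := mX i measurableT A mA; rewrite setTI => /sG.
have mgammaX : measurable_fun setT (gamma \o X).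
  exact: measurable_continuous_comp.
pose N n w := approx_index gamma n (X w).
pose Xn n w := rat_point (N n w) : 'rV[R]_d.
have GN n o : <<s G >> (N n @^-1` [set o]).
  apply: (@measurable_approx_index R d _ (g_sigma_algebraType G)) => //.
  exact: (@measurable_continuous_comp R d _ (g_sigma_algebraType G)).
have mN n o : measurable (N n @^-1` [set o]) by exact/sG.
(* the level sets of the index, numbered by natural numbers *)
pose oi k := if k is k'.+1 then Some k' else None : option nat.
pose Fk n k := N n @^-1` [set oi k].
have mFk n k : measurable (Fk n k) by exact: mN.
have FkT n : \bigcup_k Fk n k = setT.
  apply/seteqP; split=> // w _.
  by case e: (N n w) => [i|]; [exists i.+1|exists 0%N].
have tFk n : trivIset setT (Fk n).
  apply/trivIsetP => i j _ _ ij; apply/seteqP; split=> // w [] /=.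
  rewrite /Fk /= => -> /eqP; move: i j ij => [|i] [|j] //=.
  by rewrite eqSS => /negbTE ij /eqP[]; move/eqP; rewrite ij.
have mgXn n : measurable_fun setT (fun w => g (Xn n w) (V w)).
  apply: (@measurable_glue _ _ _ _ _ (N n)
    (fun o w => g (rat_point o) (V w))) => // o.
  exact: measurableT_comp.
have mgammaXn n : measurable_fun setT (fun w => gamma (Xn n w)).
  exact: (@measurable_glue _ _ _ _ _ (N n) (fun o w => gamma (rat_point o))).
have step n : (\int[P]_w (g (Xn n w) (V w))%:E =
    \int[P]_w (gamma (Xn n w))%:E)%E.
  rewrite -(FkT n) !ge0_integral_bigcup//; last 4 first.
  - by rewrite FkT; exact/measurable_EFinP.
  - by move=> w _; rewrite lee_fin.
  - by rewrite FkT; exact/measurable_EFinP.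
  - by move=> w _; rewrite lee_fin.
  apply: eq_eseriesr => k _.
  transitivity (\int[P]_(w in Fk n k) (g (rat_point (oi k)) (V w))%:E)%E.
    by apply: eq_integral => w; rewrite inE /Fk /= /Xn => ->.
  rewrite integral_indep//; last by move=> A; exact: indep (GN n (oi k)).
  transitivity (\int[P]_(w in Fk n k) (gamma (rat_point (oi k)))%:E)%E.
    by rewrite intg (integral_cst P (mFk n k) (gamma _)%:E) muleC.
  by apply: eq_integral => w; rewrite inE /Fk /= /Xn => ->.
have le_step n : (\int[P]_w (g (Xn n w) (V w))%:E <=
    \int[P]_w (gamma (X w))%:E + (n.+1%:R^-1)%:E)%E.
  rewrite step.
  apply: (@le_trans _ _ (\int[P]_w ((gamma (X w))%:E + (n.+1%:R^-1)%:E))%E).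
    apply: ge0_le_integral => //.
    - by move=> w _; rewrite lee_fin.
    - exact/measurable_EFinP.
    - by apply: emeasurable_funD => //; exact/measurable_EFinP.
    - move=> w _; rewrite -EFinD lee_fin.
      have [_] := approx_indexP cgamma n (X w).
      by move=> /ltW; rewrite ler_distlC => /andP[].
  rewrite ge0_integralD//.
  - by rewrite integral_cst_probability.
  - by move=> w _; rewrite lee_fin.
  - exact/measurable_EFinP.
apply: (@le_trans _ _ (limn_einf (fun n => \int[P]_w (g (Xn n w) (V w))%:E)%E)).
  have -> : (\int[P]_w (g (X w) (V w))%:E =
      \int[P]_w (limn_einf (fun n => (g (Xn n w) (V w))%:E)))%E.
    apply: eq_integral => w _.
    have /cvg_limn_einf_sup[-> _ //] :
        (fun n => (g (Xn n w) (V w))%:E) @ \oo --> (g (X w) (V w))%:E.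
    apply: cvg_EFin; first exact: nearW.
    apply: (@continuous_cvg _ _ _ \oo _ _ (g^~ (V w)) (X w)); first exact: cg.
    exact: cvg_rat_approx.
  apply: (@fatou _ _ _ P setT measurableT (fun n w => (g (Xn n w) (V w))%:E)).
    by move=> n; exact/measurable_EFinP.
  by move=> n w _; rewrite lee_fin.
have cvgr : (fun n => \int[P]_w (gamma (X w))%:E + (n.+1%:R^-1)%:E)%E @ \oo -->
    (\int[P]_w (gamma (X w))%:E)%E.
  rewrite -[X in _ --> X]adde0.
  apply: cvgeD; [exact: fin_num_adde_defl|exact: cvg_cst|exact: cvge_harmonic].
rewrite limn_einf_lim -[leRHS](cvg_lim _ cvgr)//; apply: lee_lim.
- exact: is_cvg_einfs.
- by apply/cvg_ex; eexists; exact: cvgr.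
- apply: nearW => n; apply: le_trans (le_step n).
  by apply: ereal_inf_lbound; exists n => /=.
Qed.

End indep.

(** * The Euclidean norm *)

Section euclidean.
Context (R : realType) (d : nat).
Implicit Types u v : 'rV[R]_d.

Lemma enorm_ge0 v : 0 <= enorm v.
Proof. exact: sqrtr_ge0. Qed.

Lemma enorm_sqr v : enorm v ^+ 2 = \sum_(i < d) v ord0 i ^+ 2.
Proof. by rewrite sqr_sqrtr// sumr_ge0// => i _; rewrite sqr_ge0. Qed.

Lemma enorm0_eq0 v : enorm v = 0 -> forall i, v ord0 i = 0.
Proof.
move=> v0 i; have := enorm_sqr v; rewrite v0 expr0n /= => /esym/eqP.
rewrite psumr_eq0 => [/allP/(_ i)|j _]; last exact: sqr_ge0.
by rewrite mem_index_enum sqrf_eq0 => /(_ isT)/eqP.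
Qed.

Lemma enormZ (a : R) v : enorm (a *: v) = `|a| * enorm v.
Proof.
rewrite /enorm -sqrtr_sqr -sqrtrM ?sqr_ge0// mulr_sumr.
by congr Num.sqrt; apply: eq_bigr => i _; rewrite mxE exprMn.
Qed.

(** Cauchy-Schwarz: expand the sum of the squares of |v| u_i - |u| v_i. *)
Lemma enorm_dot u v : \sum_(i < d) u ord0 i * v ord0 i <= enorm u * enorm v.
Proof.
set a := enorm u; set b := enorm v; set s := \sum_(i < d) _.
have [ab|ab] := eqVneq (a * b) 0.
  rewrite ab /s big1// => i _; move/eqP: ab; rewrite mulf_eq0 => /orP[]/eqP.
    by move/enorm0_eq0 => ->; rewrite mul0r.
  by move/enorm0_eq0 => ->; rewrite mulr0.
have ab0 : 0 < a * b by rewrite lt_neqAle eq_sym ab mulr_ge0// enorm_ge0.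
suff : 0 <= a * b * (a * b) *+ 2 - a * b * s *+ 2.
  by move=> h; rewrite -subr_ge0 -(pmulr_rge0 _ ab0); lra.
have : 0 <= \sum_(i < d) (b * u ord0 i - a * v ord0 i) ^+ 2.
  by apply: sumr_ge0 => i _; exact: sqr_ge0.
congr (0 <= _).
under eq_bigr do rewrite sqrrB !exprMn.
rewrite !big_split /= sumrN -!mulr_sumr -!enorm_sqr -/a -/b.
under eq_bigr do rewrite mulrACA.
by rewrite sumrMnl -mulr_sumr -/s; ring.
Qed.

Lemma ler_enormD u v : enorm (u + v) <= enorm u + enorm v.
Proof.
rewrite -(@ler_pXn2r _ 2)// ?nnegrE ?addr_ge0 ?enorm_ge0//.
rewrite sqrrD !enorm_sqr.
under eq_bigr do rewrite mxE sqrrD.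
rewrite !big_split /= lerD2r lerD2l.
by rewrite mulr2n lerD// enorm_dot.
Qed.

Lemma enorm_le_rel_err (gf g : 'rV[R]_d -> 'rV[R]_d) (c0 : R) x : 0 < c0 ->
  enorm (gf x) <=
  enorm (g x) + enorm (rel_err gf c0 g x) * (enorm (gf x) + c0).
Proof.
move=> c00; have z0 : 0 < enorm (gf x) + c0 by rewrite ltr_wpDl// enorm_ge0.
rewrite /rel_err enormZ ger0_norm ?invr_ge0 ?(ltW z0)// mulrAC.
rewrite mulVf ?gt_eqF// mul1r.
have -> : enorm (g x - gf x) = enorm (gf x - g x).
  by rewrite -opprB -scaleN1r enormZ normrN1 mul1r.
by have := ler_enormD (gf x - g x) (g x); rewrite subrK addrC.
Qed.

End euclidean.

Lemma measurable_enorm (R : realType) (d : nat) d1 (T : measurableType d1)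
    (V : T -> 'rV[R]_d) :
  (forall i, measurable_fun setT (fun w => V w ord0 i)) ->
  measurable_fun setT (fun w => enorm (V w)).
Proof.
move=> mV; apply: (measurableT_comp (f := @Num.sqrt R)).
  by apply: continuous_measurable_fun; exact: sqrt_continuous.
by apply: measurable_sum => i; exact: measurable_funX.
Qed.

(** * Deterministic estimates *)

(** While the tolerance eps is not met at t >= 1, squaring the convergence bound
gives eps^2 t < C^2 (h (x 0) - b).  This fails for large t, so the solver stops;
the bound is applied at the step before the stopping time, whence the 1. *)
Lemma sublinear_stop (R : realType) (d : nat) (h : 'rV[R]_d -> R)
    (gh : 'rV[R]_d -> 'rV[R]_d) (x : nat -> 'rV[R]_d) (c C b eps : R) :
    0 < c <= C -> sublinear_half h gh x c -> (forall z, b <= h z) -> 0 < eps ->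
  exists2 t, first_time (fun t => enorm (gh (x t)) <= eps) = Some t &
    t%:R <= 1 + C ^+ 2 / eps ^+ 2 * (h (x 0%N) - b).
Proof.
move=> /andP[c0 cC] sub hb eps0; set Q := C ^+ 2 / _ * _.
have Q0 : 0 <= Q.
  by rewrite mulr_ge0 ?divr_ge0 ?sqr_ge0// subr_ge0.
have small t : (1 <= t)%N -> ~~ (enorm (gh (x t)) <= eps) -> t%:R < Q.
  move=> t1; rewrite -ltNge => epst; have [h0t gt _] := sub t t1.
  have t0 : 0 < t%:R :> R by rewrite ltr0n.
  have : eps ^+ 2 < (c * Num.sqrt (h (x 0%N) - h (x t)) / Num.sqrt t%:R) ^+ 2.
    by rewrite ltr_pXn2r ?nnegrE ?(ltW eps0)// ?(lt_le_trans epst)//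
      ?divr_ge0 ?mulr_ge0 ?sqrtr_ge0 ?(ltW c0).
  rewrite expr_div_n exprMn !sqr_sqrtr ?subr_ge0 ?(ltW t0)//.
  rewrite ltr_pdivlMr// => lt1.
  rewrite /Q mulrAC ltr_pdivlMr ?exprn_gt0// mulrC.
  apply: lt_le_trans lt1 _; apply: ler_pM; rewrite ?sqr_ge0 ?subr_ge0//.
    by rewrite lerXn2r ?nnegrE ?(ltW c0) ?(le_trans (ltW c0)).
  by rewrite lerB.
case e: first_time => [t|].
  exists t => //; case: t e => [|[|t]] e.
  - by rewrite addr_ge0.
  - by rewrite lerDl.
  - have /ltW := small t.+1 isT (first_time_min e (ltnSn _)).
    by rewrite -[t.+2%:R]natr1 [in X in _ -> X]addrC lerD2l.
have := small (Num.truncn Q).+1 isT (first_time_None _ e).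
by move=> /lt_trans/(_ (truncnS_gt Q)); rewrite ltxx.
Qed.

(** In the next two lemmas, s is the square root of the sample size, z the norm
of the true gradient and rho that of the relative error.  Here the products
s rho z and s rho c0 are both split by Young's inequality. *)
Lemma young_bound_sqr (R : realType) (s z rho c0 c2 : R) : 0 <= s ->
  s * z <= c2 + s * rho * (z + c0) ->
  s * z <= (c2 + c0 ^+ 2 / 2) + (s * rho) ^+ 2 + z ^+ 2 / 2.
Proof.
move=> s0; set u := s * rho => /le_trans; apply.
have := sqr_ge0 (u - z); have := sqr_ge0 (u - c0); nra.
Qed.

(** Let u = s rho (z ^ alpha + delta0).  If rho <= 1/2, then the term s rho z is
at most half of s z, and s rho <= u / delta0.  If rho > 1/2, then
(s z) ^ alpha <= s z ^ alpha <= 2 u because s >= 1.  In both cases s z is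
controlled by u ^ (1 / alpha), as u <= 1 + u ^ (1 / alpha). *)
Lemma young_bound_pow (R : realType) (alpha delta0 s z rho c0 c2 : R) :
    0 < alpha < 1 -> 0 < delta0 -> 1 <= s -> 0 <= z -> 0 <= rho -> 0 <= c0 ->
    0 <= c2 ->
    s * z <= c2 + s * rho * (z + c0) ->
  s * z <= (2 * c2 + 2 * c0 / delta0) +
    (2 * c0 / delta0 + 2 `^ alpha^-1)
    * (s * (rho * (z `^ alpha + delta0))) `^ alpha^-1.
Proof.
move=> /andP[a0 a1] d0 s1 z0 rho0 c00 c20 hz.
set u := s * (rho * _); set v := u `^ _.
have s0 : 0 < s by exact: lt_le_trans s1.
have u0 : 0 <= u by rewrite !mulr_ge0 ?addr_ge0 ?powR_ge0// ltW.
have v0 : 0 <= v by exact: powR_ge0.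
have p0 : 0 <= 2 `^ alpha^-1 :> R by exact: powR_ge0.
have uv : u <= 1 + v.
  have [u1|u1] := leP u 1; first by apply: le_trans u1 _; rewrite lerDl.
  rewrite ler_wpDl// -[leLHS]powRr1// /v ler_powR ?(ltW u1)//.
  by rewrite invf_ge1// ltW.
have cd0 : 0 <= 2 * c0 / delta0 by rewrite divr_ge0 ?mulr_ge0// ltW.
have [rho2|rho2] := leP rho 2^-1.
  have srho : s * rho <= u / delta0.
    rewrite ler_pdivlMr// /u -mulrA ler_wpM2l ?(ltW s0)//.
    by rewrite ler_wpM2l// lerDr powR_ge0.
  have h1 : s * rho * z <= s * z / 2.
    by rewrite mulrAC ler_wpM2l// mulr_ge0// ltW.
  have h2 : s * rho * c0 <= c0 / delta0 * (1 + v).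
    apply: (@le_trans _ _ (u / delta0 * c0)); first by rewrite ler_wpM2r.
    have -> : u / delta0 * c0 = c0 / delta0 * u by ring.
    by rewrite ler_wpM2l// divr_ge0// ltW.
  have h3 : 0 <= 2 `^ alpha^-1 * v by rewrite mulr_ge0.
  move: hz h1 h2 h3; rewrite mulrDr mulrDl.
  rewrite -[2 * c0 / delta0]mulrA; set q := c0 / delta0.
  set r := 2 `^ alpha^-1 * v.
  move: (s * z) (s * rho * z) (s * rho * c0) => S1 S2 S3; nra.
have : (s * z) `^ alpha <= 2 * u.
  rewrite powRM ?(ltW s0)//.
  apply: (@le_trans _ _ (s * z `^ alpha)).
    rewrite ler_wpM2r ?powR_ge0// -[leRHS]powRr1 ?(ltW s0)//.
    by rewrite ler_powR// ltW.
  have zd : z `^ alpha <= z `^ alpha + delta0 by rewrite lerDl ltW.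
  have : z `^ alpha <= 2 * (rho * (z `^ alpha + delta0)).
    move: zd (powR_ge0 z alpha); move: (z `^ alpha) => q; nra.
  by move=> h; rewrite /u mulrCA ler_pM2l.
move=> sz.
have H : s * z <= (2 * u) `^ alpha^-1.
  have -> : s * z = ((s * z) `^ alpha) `^ alpha^-1.
    by rewrite -powRrM mulfV ?gt_eqF// powRr1// mulr_ge0// ltW.
  apply: ge0_ler_powR => //.
  - by rewrite invr_ge0 ltW.
  - by rewrite nnegrE powR_ge0.
  - by rewrite nnegrE mulr_ge0.
apply: le_trans H _; rewrite powRM// -/v.
have := mulr_ge0 cd0 v0; move: cd0 (2 `^ alpha^-1).
by move: (2 * c0 / delta0) => *; lra.
Qed.

(** * Geometrically growing sample sizes *)

Section sizes.
Context (R : realType) (M : nat -> nat) (c1 : R).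
Hypotheses (M1 : (0 < M 1)%N) (c1_gt1 : 1 < c1).
Hypothesis MS : forall k, (2 <= k)%N -> (M k)%:R = c1 * (M k.-1)%:R.

Let c1_gt0 : 0 < c1. Proof. exact: lt_trans c1_gt1. Qed.

Lemma sample_sizeS k : (M k.+2)%:R = c1 * (M k.+1)%:R.
Proof. by rewrite MS. Qed.

Lemma sample_size_gt0 k : (0 < M k.+1)%N.
Proof.
elim: k => // k ih; rewrite -(ltr_nat R) sample_sizeS mulr_gt0//.
by rewrite ltr0n.
Qed.

Lemma sum_sqr_sample_size k :
  \sum_(1 <= j < k.+2) (M j)%:R ^+ 2 <=
  c1 ^+ 2 / (c1 ^+ 2 - 1) * (M k.+1)%:R ^+ 2.
Proof.
have c0 : 0 < c1 ^+ 2 - 1 by rewrite subr_gt0 exprn_egt1.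
elim: k => [|k ih].
  rewrite big_nat1 ler_peMl ?sqr_ge0// ler_pdivlMr// mul1r.
  by rewrite lerBlDr lerDl.
rewrite big_nat_recr//=; apply: le_trans (lerD ih (lexx _)) _.
rewrite sample_sizeS exprMn.
rewrite le_eqVlt; apply/orP; left; apply/eqP; field.
by rewrite gt_eqF.
Qed.

Lemma sample_size_unbounded (T : R) : exists k, T <= (M k.+1)%:R.
Proof.
have c0 : 0 < c1 - 1 by rewrite subr_gt0.
have ge k : 1 + k%:R * (c1 - 1) <= (M k.+1)%:R.
  elim: k => [|k ih]; first by rewrite mul0r addr0 ler1n.
  have m1 : 0 <= (M k.+1)%:R - 1 :> R by rewrite subr_ge0 ler1n sample_size_gt0.
  have := mulr_ge0 (ltW c0) m1; rewrite sample_sizeS -natr1; lra.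
exists (Num.truncn (T / (c1 - 1))).+1.
apply: le_trans (ge _); have /ltW := truncnS_gt (T / (c1 - 1)).
by rewrite ler_pdivrMr// => h; rewrite ler_wpDl.
Qed.

(** Take the first sample size that reaches T: unless it is M 1, it is c1 times a
sample size below T. *)
Lemma exists_sample_size (T : R) : (M 1)%:R <= T ->
  exists2 k, T <= (M k.+1)%:R & (M k.+1)%:R <= c1 * T.
Proof.
move=> MT; have ex := sample_size_unbounded T.
case: (ex_minnP ex) => -[|k] Tk kmin; [exists 0%N|exists k.+1] => //.
  by apply: (le_trans MT); rewrite ler_peMl ?(ltW c1_gt1)// (le_trans _ MT).
rewrite sample_sizeS ler_pM2l// leNgt; apply/negP => /ltW/kmin.
by rewrite ltnn.
Qed.

Lemma nobsS k : nobs M k.+1 = (nobs M k + M k.+1)%N.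
Proof. by rewrite /nobs big_nat_recr. Qed.

End sizes.

(** * Integrability and integral bounds *)

Section integral_lemmas.
Context (R : realType) (d1 : measure_display) (T : measurableType d1).
Local Open Scope ereal_scope.

Lemma integrable_of_funeposneg (m : {measure set T -> \bar R})
    (f : T -> \bar R) :
  measurable_fun setT f -> \int[m]_x f^\+ x < +oo ->
  \int[m]_x f^\- x < +oo -> m.-integrable setT f.
Proof.
move=> mf fp fm; apply/integrableP; split=> //.
rewrite -/(abse \o f) fune_abse ge0_integralD//; last 2 first.
- exact: measurable_funepos.
- exact: measurable_funeneg.
by rewrite lte_add_pinfty.
Qed.

Lemma integrable_of_gtNy (m : {measure set T -> \bar R}) (f : T -> \bar R) :
  measurable_fun setT f -> \int[m]_x f^\+ x < +oo -> -oo < \int[m]_x f x ->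
  m.-integrable setT f.
Proof.
move=> mf fp; rewrite integralE => fN; apply: integrable_of_funeposneg => //.
move: fp fN; case: (\int[m]_x f^\+ x) => [p| |] //;
  by case: (\int[m]_x f^\- x) => [n| |] //=; rewrite ?ltry.
Qed.

Lemma integrable_of_lty (m : {measure set T -> \bar R}) (f : T -> \bar R) :
  measurable_fun setT f -> \int[m]_x f^\- x < +oo -> \int[m]_x f x < +oo ->
  m.-integrable setT f.
Proof.
move=> mf fm; rewrite integralE => fy; apply: integrable_of_funeposneg => //.
move: fm fy; case: (\int[m]_x f^\- x) => [n| |] //;
  by case: (\int[m]_x f^\+ x) => [p| |] //=; rewrite ?ltry.
Qed.

Lemma integrable_ge_cst (P : probability T R) (f : T -> R) (b : R) :
  measurable_fun setT f -> (forall x, (b <= f x)%R) ->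
  \int[P]_x (f x)%:E < +oo -> P.-integrable setT (EFin \o f).
Proof.
move=> mf bf; apply: integrable_of_lty; first exact/measurable_EFinP.
apply: (@le_lt_trans _ _ (\int[P]_x `|b|%:E)).
  apply: ge0_le_integral => //; first exact/measurable_funeneg/measurable_EFinP.
  move=> x _; rewrite funenegE /= -?EFinN -EFin_max lee_fin.
  rewrite ge_max normr_ge0 andbT.
  by rewrite lerNl (le_trans _ (bf x))// lerNl -normrN ler_norm.
by rewrite integral_cst_probability ltry.
Qed.

(** The full space is in G, so X and its conditional expectation have the same
integral. *)
Lemma cond_exp_le_integral (P : probability T R) (G : set (set T))
    (X : T -> \bar R) (c : R) : G setT -> G `<=` measurable -> (0 <= c)%R ->
    cond_exp_le P G X c ->
  [/\ measurable_fun setT X, (forall w, 0 <= X w) & \int[P]_w X w <= c%:E].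
Proof.
move=> GT mG c0 [Z [[[mX X0] [mZ Z0] XZ] Zc]]; split=> //.
rewrite -(XZ _ GT) -(integral_cst_probability P c).
apply: ae_ge0_le_integral => //.
- by move=> _ B mB; rewrite setTI; exact/mG/mZ.
- by apply: filterS Zc => w + _.
Qed.

Lemma integral_affine_le (P : probability T R) (Q : T -> \bar R)
    (V : T -> \bar R) (a b v : R) :
    (0 <= a)%R -> (0 <= b)%R ->
    measurable_fun setT Q -> (forall w, 0 <= Q w) ->
    measurable_fun setT V -> (forall w, 0 <= V w) ->
    {ae P, forall w, Q w <= a%:E + b%:E * V w} ->
    \int[P]_w V w <= v%:E ->
  \int[P]_w Q w <= (a + b * v)%:E.
Proof.
move=> a0 b0 mQ Q0 mV V0 QV Vv.
have mbV : measurable_fun setT (fun w => b%:E * V w) by exact: emeasurable_funM.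
have bV0 w : 0 <= b%:E * V w by rewrite mule_ge0// lee_fin.
apply: (@le_trans _ _ (\int[P]_w (a%:E + b%:E * V w))).
  apply: ae_ge0_le_integral => //.
  - by move=> w _; rewrite adde_ge0// lee_fin.
  - exact: emeasurable_funD.
  - by apply: filterS QV.
rewrite ge0_integralD// integral_cst_probability ge0_integralZl//.
by rewrite EFinD EFinM leeD2l// lee_wpmul2l ?lee_fin.
Qed.

End integral_lemmas.

(** * The lower envelope of the random objective *)

(** By continuity the infimum over all points is the infimum over the rational
ones, which is countable; it is written as the term of index 0 of einfs. *)
Lemma measurable_lower_envelope (R : realType) (d : nat) d1
    (T : measurableType d1) (F : 'rV[R]_d -> T -> R) :
    (forall y, continuous (F^~ y)) -> (forall x, measurable_fun setT (F x)) ->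
  measurable_fun setT (fun y => ereal_inf (range (fun x => (F x y)%:E))).
Proof.
move=> cF mF; pose u n y := (F (rat_point (Some n)) y)%:E.
rewrite (_ : (fun _ => _) = fun y => einfs (u^~ y) 0).
  by apply: measurable_fun_einfs => n; exact/measurable_EFinP.
apply/funext => y; apply/eqP; rewrite eq_le; apply/andP; split.
  apply: ereal_inf_le_tmp => _ [n /= _ <-]; by exists (rat_point (Some n)).
apply: le_ereal_inf_tmp => _ [x _ <-]; apply/lee_addgt0Pr => e e0.
have /nbhs_ballP[r /= r0 hr] : nbhs x [set z | F z y < F x y + e].
  have /cvgr_lt := @cF y x; apply.
  by rewrite ltrDl.
have [i /hr /ltW xi] := @rat_point_dense R d x r r0.
apply: (@le_trans _ _ (u i y)); last by rewrite -EFinD lee_fin.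
by apply: ereal_inf_lbound; exists i.
Qed.

(** The infimum is below the integrable function F 0, so a finite lower bound on
its integral makes it integrable, hence finite almost everywhere; J is its real
part. *)
Lemma real_lower_envelope (R : realType) (d : nat) (dY : measure_display)
    (Y : measurableType dY) (mu : probability Y R) (F : 'rV[R]_d -> Y -> R) :
    (forall y, continuous (F^~ y)) ->
    (forall x, mu.-integrable setT (fun y => (F x y)%:E)) ->
    (-oo < \int[mu]_y ereal_inf (range (fun x => (F x y)%:E)))%E ->
  exists J : Y -> R,
    [/\ measurable_fun setT J, mu.-integrable setT (EFin \o J),
        {ae mu, forall y, forall x, J y <= F x y} &
        (\int[mu]_y (J y)%:E =
         \int[mu]_y ereal_inf (range (fun x => (F x y)%:E)))%E].
Proof.
move=> cF iF; set I := fun y => ereal_inf _ => Igt.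
have mF x : measurable_fun setT (F x).
  by apply/measurable_EFinP; exact: measurable_int (iF x).
have mI : measurable_fun setT I by exact: measurable_lower_envelope.
have IF x y : (I y <= (F x y)%:E)%E by apply: ereal_inf_lbound; exists x.
have iI : mu.-integrable setT I.
  apply: integrable_of_gtNy => //.
  apply: (@le_lt_trans _ _ (\int[mu]_y ((fun y => (F 0 y)%:E)^\+ y))%E).
    apply: ge0_le_integral => //.
    - exact: measurable_funepos.
    - by apply: measurable_funepos; exact/measurable_EFinP.
    - by move=> y _; rewrite !funeposE ge_max le_max IF/= le_max lexx orbT.
  exact: integral_funepos_lt_pinfty (iF 0).
have finI : {ae mu, forall y, I y \is a fin_num}.
  by apply: filterS (integrable_ae measurableT iI) => y; apply.
have mJ : measurable_fun setT (fine \o I).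
  exact: measurableT_comp (@fine_measurable R setT measurableT) mI.
have IJ : {ae mu, forall y, setT y -> I y = (fine (I y))%:E}.
  by apply: filterS finI => y fy _; rewrite fineK.
have mJ' : measurable_fun setT (EFin \o (fine \o I)) by exact/measurable_EFinP.
exists (fine \o I); split=> //.
- apply/integrableP; split=> //.
  have [_] := integrableP _ _ _ iI; apply: le_lt_trans.
  apply: ae_ge0_le_integral => //; try exact: measurableT_comp.
  by apply: filterS finI => y fy _; rewrite /= -[in leRHS](fineK fy).
- by apply: filterS finI => y fy x; rewrite -lee_fin /= fineK.
- by apply: ae_eq_integral => //; apply: filterS IJ => y + _ => <-.
Qed.

(** The absolute value makes the integrand nonnegative and continuous in h
everywhere, and not only where J <= h. *)
Lemma integral_gap (R : realType) (dY : measure_display)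
    (Y : measurableType dY) (mu : probability Y R) (h J : Y -> R) :
    mu.-integrable setT (EFin \o h) -> mu.-integrable setT (EFin \o J) ->
    {ae mu, forall y, J y <= h y} ->
  (\int[mu]_y `|h y - J y|%:E =
   (Rintegral mu setT h - Rintegral mu setT J)%:E)%E.
Proof.
move=> ih iJ Jh.
have mh : measurable_fun setT h by apply/measurable_EFinP; exact: measurable_int ih.
have mJ : measurable_fun setT J by apply/measurable_EFinP; exact: measurable_int iJ.
have mD : measurable_fun setT (h \- J) by exact: measurable_funB.
rewrite (ae_eq_integral (fun y => (h y)%:E - (J y)%:E)%E) //.
- rewrite integralB// /Rintegral EFinB !fineK//; exact: integrable_fin_num.
- by apply/measurable_EFinP; exact: measurableT_comp.
- by apply/emeasurable_funB; exact/measurable_EFinP.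
- by apply: filterS Jh => y Jy _; rewrite ger0_norm ?subr_ge0// EFinB.
Qed.

Lemma ae_foralln (R : realType) (d1 : measure_display) (T : measurableType d1)
    (m : {measure set T -> \bar R}) (Q : nat -> T -> Prop) :
    (forall j, {ae m, forall w, Q j w}) ->
  {ae m, forall w, forall j, Q j w}.
Proof.
move=> mQ; rewrite /almost_everywhere /=.
apply: (@negligibleS _ _ _ _ (\bigcup_j ~` [set w | Q j w])).
  by move=> w /= /existsNP[j Qj]; exists j.
by apply: negligible_bigcup => j; exact: mQ.
Qed.

(** * Measurability of the outer iterates *)

Section retrospective_approximation.
Context (R : realType) (d : nat) (dO dY : measure_display)
  (Omega : measurableType dO) (P : probability Omega R)
  (Y : measurableType dY) (mu : probability Y R)
  (F : 'rV[R]_d -> Y -> R) (Yt : nat -> Omega -> Y)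
  (S : solver_type R d) (x0 : 'rV[R]_d) (M : nat -> nat)
  (C2 CM : nat -> Omega -> R) (c1 c2_lo c2 C : R).
Let f := objective mu F.
Let gf := grad f.
Let Fk k := sigma_first Yt (nobs M k).
Let eps k w := C2 k w / Num.sqrt (M k)%:R.
Let X k w := ra_iter F S M (eps^~ w) x0 (Yt^~ w) k.
Let Xin k t w := ra_inner F S M (Yt^~ w) k (X k.-1 w) t.
Let W k w := ra_work F S M (eps^~ w) x0 (Yt^~ w) k.
Let steps k w := ra_steps F S M (eps^~ w) x0 (Yt^~ w) k.
Let fM k w := sample_fun F (M k) (batch M (Yt^~ w) k).
Let gfM k w := sample_grad F (M k) (batch M (Yt^~ w) k).
Let stop k w := ra_stop F S M (eps^~ w) (Yt^~ w) k (X k.-1 w).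

Hypothesis F_smooth : forall y, smooth (F^~ y).
Hypothesis F_int : forall x, mu.-integrable setT (fun y => (F x y)%:E).
Hypothesis f_diff : forall x, differentiable f x.
Hypothesis gradF_int : forall x i,
  mu.-integrable setT (fun y => (grad (F^~ y) x ord0 i)%:E).
Hypothesis Y_iid : iid P mu Yt.
Hypothesis M_gt0 : forall k, (0 < M k.+1)%N.
Hypothesis C2P : forall k, (1 <= k)%N ->
  measurable_wrt (Fk k.-1) (C2 k) /\ forall w, c2_lo <= C2 k w <= c2.
Hypothesis c2_lo_gt0 : 0 < c2_lo.
Hypothesis S0 : forall k h x, S k h x 0%N = x.
Hypothesis Xin_meas : forall k t i, (1 <= k)%N ->
  measurable_wrt (Fk k) (fun w => Xin k t w ord0 i).
Hypothesis sublin : forall k, (1 <= k)%N -> {ae P, forall w,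
  0 < CM k w <= C /\
  sublinear_half (fM k w) (gfM k w) (fun t => Xin k t w) (CM k w)}.

Lemma iterS k w :
  X k.+1 w = if stop k.+1 w is Some t then Xin k.+1 t w else X k w.
Proof. by []. Qed.

Lemma Xin0 k w : Xin k.+1 0%N w = X k w.
Proof. exact: S0. Qed.

Lemma sample_grad_meas k t i :
  measurable_wrt (Fk k.+1) (fun w => gfM k.+1 w (Xin k.+1 t w) ord0 i).
Proof.
apply/measurable_wrtP.
rewrite (_ : (fun _ => _) = fun w => (M k.+1)%:R^-1 *
    \sum_(j < M k.+1) grad (F^~ (Yt (nobs M k + j)%N w)) (Xin k.+1 t w) ord0 i).
  apply: measurable_funM; first exact: measurable_cst.
  apply: measurable_sum => j.
  apply: (@measurable_caratheodory R d _ (past_type Yt (nobs M k.+1))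
    (Xin k.+1 t) _ (fun x w => grad (F^~ (Yt (nobs M k + j)%N w)) x ord0 i)).
  - by move=> i'; apply/measurable_wrtP; exact: Xin_meas.
  - move=> w x; apply: (@continuous_comp _ _ _ (grad (F^~ _))
      (fun v : 'rV[R]_d => v ord0 i)); first exact: (F_smooth _).2.
    exact: coord_continuous.
  - move=> x.
    apply: (@measurableT_comp _ _ _ _ _ _ (fun y => grad (F^~ y) x ord0 i)).
      by apply/measurable_EFinP; exact: measurable_int (gradF_int x i).
    have jM : (nobs M k + j < nobs M k.+1)%N by rewrite nobsS ltn_add2l.
    by have /measurable_wrtP := measurable_wrt_obs (Yt := Yt) jM.
by apply/funext => w; rewrite /gfM /sample_grad mxE summxE.
Qed.

(** Stopping at iteration k + 1 is decided by the sample gradients at the inner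
iterates and by the tolerance, which depend on the first k + 1 batches. *)
Lemma stop_meas k o : Fk k.+1 (stop k.+1 @^-1` [set o]).
Proof.
apply: (@measurable_first_time _ (past_type Yt (nobs M k.+1))) => t.
apply: measurable_fun_ler.
  by apply: measurable_enorm => i; apply/measurable_wrtP; exact: sample_grad_meas.
apply: measurable_funM; last exact: measurable_cst.
apply/measurable_wrtP; apply: (@sub_measurable_wrt _ _ _ _ _ _ _ (nobs M k)).
  by rewrite nobsS leq_addr.
by have [] := C2P (ltn0Sn k).
Qed.

(** When the solver does not stop, the iterate is unchanged; as the solver starts
from it, this is the inner iterate of index 0. *)
Lemma iter_meas k i : measurable_wrt (Fk k) (fun w => X k w ord0 i).
Proof.
case: k => [|k]; first by apply/measurable_wrtP; exact: measurable_cst.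
apply/measurable_wrtP.
rewrite (_ : (fun _ => _) = fun w => Xin k.+1 (odflt 0%N (stop k.+1 w)) w ord0 i).
  apply: (@measurable_glue _ _ (past_type Yt (nobs M k.+1)) _ _ (stop k.+1)
    (fun o w => Xin k.+1 (odflt 0%N o) w ord0 i)); first exact: stop_meas.
  by move=> o; apply/measurable_wrtP; exact: Xin_meas.
by apply/funext => w; rewrite iterS; case: (stop k.+1 w) => //=; rewrite Xin0.
Qed.

Lemma iter_measurable k i : measurable_fun setT (fun w => X k w ord0 i).
Proof. exact: (measurable_wrt_fun Y_iid (@iter_meas k i)). Qed.

Lemma f_cont : continuous f.
Proof. by move=> x; exact: differentiable_continuous. Qed.

Lemma objective_iter_measurable k : measurable_fun setT (f \o X k).
Proof. by apply: measurable_continuous_comp f_cont; exact: iter_measurable. Qed.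

Lemma gradient_iter_measurable k :
  measurable_fun setT (fun w => enorm (gf (X k w))).
Proof.
apply: measurable_enorm => i.
rewrite (_ : (fun _ => _) = fun w => 'D_(delta_mx ord0 i) f (X k w)).
  by apply: measurable_partial => //; exact: iter_measurable.
by apply/funext => w; rewrite /gf /grad mxE.
Qed.

Lemma steps_measurable k : measurable_fun setT (steps k.+1).
Proof.
apply: (@measurable_glue _ _ _ _ _ (stop k.+1)
  (fun o _ => if o is Some t then t%:R%:E else +oo%E)) => o.
  by apply: (sigma_first_measurable Y_iid); exact: stop_meas.
exact: measurable_cst.
Qed.

Lemma steps_ge0 k w : (0 <= steps k w)%E.
Proof. by rewrite /steps /ra_steps; case: ra_stop => // t; rewrite lee_fin. Qed.

(** * Work of one outer iteration *)

Context (J : Y -> R) (gap_bound : R).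
Hypothesis J_meas : measurable_fun setT J.
Hypothesis J_int : mu.-integrable setT (EFin \o J).
Hypothesis J_le : {ae mu, forall y, forall x, J y <= F x y}.
Let mean_gap x := f x - Rintegral mu setT J.
Hypothesis mean_gap_le : forall k,
  (\int[P]_w (mean_gap (X k w))%:E <= gap_bound%:E)%E.

(* nonnegative and continuous in x even where J is not a lower bound *)
Let gap x y := `|F x y - J y|.
Let sample_gap k w := (M k.+1)%:R^-1 *
  \sum_(j < M k.+1) gap (X k w) (Yt (nobs M k + j)%N w).

Lemma obs_ae (Q : Y -> Prop) j :
  {ae mu, forall y, Q y} -> {ae P, forall w, Q (Yt j w)}.
Proof.
move=> [N [mN N0 QN]]; exists (Yt j @^-1` N); split.
- by rewrite -[X in measurable X]setTI; exact: (measurable_obs Y_iid).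
- by rewrite (law_obs Y_iid).
- by move=> w /=; exact: QN.
Qed.

Lemma J_le_all :
  {ae P, forall w, forall j x, J (Yt j w) <= F x (Yt j w)}.
Proof.
apply: (@ae_foralln _ _ _ P (fun j w => forall x, J (Yt j w) <= F x (Yt j w))) => j.
exact: (@obs_ae (fun y => forall x, J y <= F x y)).
Qed.

Lemma mean_gap_cont : continuous mean_gap.
Proof.
move=> x; apply: (@continuousB _ _ _ f (cst _) x); first exact: f_cont.
exact: cst_continuous.
Qed.

Lemma gap_cont y : continuous (gap^~ y).
Proof.
move=> x; apply: (@continuous_comp _ _ _ (fun x => F x y - J y) Num.norm);
  last exact: norm_continuous.
apply: (@continuousB _ _ _ (F^~ y) (cst _) x); last exact: cst_continuous.
exact/differentiable_continuous/(F_smooth y).1.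
Qed.

Lemma gap_meas x : measurable_fun setT (gap x).
Proof.
apply: measurableT_comp => //; apply: measurable_funB => //.
by apply/measurable_EFinP; exact: measurable_int (F_int x).
Qed.

Lemma gap_int x : (\int[mu]_y (gap x y)%:E = (mean_gap x)%:E)%E.
Proof.
by apply: (integral_gap (F_int x) J_int); apply: filterS J_le => y; exact.
Qed.

Lemma gap_obs_meas k j : measurable_fun setT (fun w => gap (X k w) (Yt j w)).
Proof.
apply: (@measurable_caratheodory R d _ _ (X k) _ (fun x w => gap x (Yt j w))).
- exact: iter_measurable.
- by move=> w; exact: gap_cont.
- by move=> x; exact: measurableT_comp (gap_meas x) (measurable_obs Y_iid j).
Qed.

(** Observations of index at least nobs M k are independent of X k, which is a
function of the earlier ones. *)
Lemma gap_obs_int k j : (nobs M k <= j)%N ->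
  (\int[P]_w (gap (X k w) (Yt j w))%:E <= gap_bound%:E)%E.
Proof.
move=> kj; apply: le_trans (mean_gap_le k).
apply: (@integral_indep_comp_le R _ _ _ _ P mu d (past_events Yt (nobs M k))
  (X k) (Yt j) gap mean_gap).
- exact: sigma_first_measurable Y_iid _.
- by move=> i; apply/measurable_wrtP; exact: iter_meas.
- exact: measurable_obs Y_iid j.
- by move=> B A; exact: (sigma_first_indep Y_iid kj).
- exact: gap_cont.
- exact: gap_meas.
- by move=> x y; exact: normr_ge0.
- exact: mean_gap_cont.
- exact: gap_int.
Qed.

Lemma sample_gap_ge0 k w : 0 <= sample_gap k w.
Proof.
by rewrite mulr_ge0 ?invr_ge0// sumr_ge0// => j _; exact: normr_ge0.
Qed.

Lemma sample_gap_meas k : measurable_fun setT (sample_gap k).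
Proof.
apply: measurable_funM; first exact: measurable_cst.
by apply: measurable_sum => j; exact: gap_obs_meas.
Qed.

Lemma sample_gap_int k : (\int[P]_w (sample_gap k w)%:E <= gap_bound%:E)%E.
Proof.
have M0 : 0 < (M k.+1)%:R :> R by rewrite ltr0n.
have mg j : measurable_fun setT (fun w => (gap (X k w) (Yt j w))%:E).
  by apply/measurable_EFinP; exact: gap_obs_meas.
have -> : (\int[P]_w (sample_gap k w)%:E =
    ((M k.+1)%:R^-1)%:E *
    \sum_(j < M k.+1) \int[P]_w (gap (X k w) (Yt (nobs M k + j)%N w))%:E)%E.
  transitivity (\int[P]_w (((M k.+1)%:R^-1)%:E *
      \sum_(j < M k.+1) (gap (X k w) (Yt (nobs M k + j)%N w))%:E))%E.
    by apply: eq_integral => w _; rewrite /sample_gap EFinM sumEFin.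
  rewrite ge0_integralZl//; last 2 first.
  - exact: emeasurable_sum.
  - by move=> w _; apply: sume_ge0 => j _; rewrite lee_fin normr_ge0.
  rewrite ge0_integral_sum// => j w _.
  by rewrite lee_fin normr_ge0.
apply: (@le_trans _ _ (((M k.+1)%:R^-1)%:E * \sum_(j < M k.+1) gap_bound%:E)%E).
  rewrite lee_pmul2l ?lte_fin ?invr_gt0//.
  by apply: lee_sum => j _; apply: gap_obs_int; exact: leq_addr.
rewrite sumEFin -EFinM lee_fin sumr_const card_ord.
by rewrite -[gap_bound *+ _]mulr_natl mulrA mulVf ?mul1r// gt_eqF.
Qed.

(** The sample mean of J bounds the sample objective from below, so
[sublinear_stop] applies with it, and eps >= c2_lo / sqrt M. *)
Lemma stop_ae k : {ae P, forall w, exists2 t, stop k.+1 w = Some t &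
  t%:R <= 1 + C ^+ 2 / c2_lo ^+ 2 * (M k.+1)%:R * sample_gap k w}.
Proof.
have M0 : 0 < (M k.+1)%:R :> R by rewrite ltr0n.
apply: filterS2 (sublin (ltn0Sn k)) J_le_all => w [cC sub] Jw.
have [_ /(_ w) /andP[C2lo _]] := C2P (ltn0Sn k).
have C20 : 0 < C2 k.+1 w by exact: lt_le_trans C2lo.
pose obs j := Yt (nobs M k + j)%N w.
pose b := (M k.+1)%:R^-1 * \sum_(j < M k.+1) J (obs j).
have bf z : b <= fM k.+1 w z.
  rewrite ler_wpM2l ?invr_ge0 ?(ltW M0)// ler_sum// => j _; exact: Jw.
have eps0 : 0 < eps k.+1 w by rewrite divr_gt0// sqrtr_gt0.
have [t st tle] := sublinear_stop cC sub bf eps0.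
exists t => //; apply: le_trans tle _; rewrite lerD2l Xin0.
have -> : C ^+ 2 / eps k.+1 w ^+ 2 = C ^+ 2 / C2 k.+1 w ^+ 2 * (M k.+1)%:R.
  rewrite /eps expr_div_n sqr_sqrtr ?(ltW M0)//; field.
  by rewrite !gt_eqF.
apply: ler_pM.
- by rewrite mulr_ge0 ?divr_ge0 ?sqr_ge0// ltW.
- by rewrite subr_ge0.
- rewrite ler_wpM2r ?(ltW M0)// ler_wpM2l ?sqr_ge0//.
  rewrite lef_pV2 ?posrE ?exprn_gt0//.
  by rewrite lerXn2r ?nnegrE ?(ltW C20) ?(ltW c2_lo_gt0).
- rewrite /b /fM /sample_fun -mulrBr ler_wpM2l ?invr_ge0 ?(ltW M0)//.
  by rewrite -sumrB ler_sum// => j _; exact: ler_norm.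
Qed.

Lemma steps_int k : (\int[P]_w steps k.+1 w <=
  (1 + C ^+ 2 / c2_lo ^+ 2 * (M k.+1)%:R * gap_bound)%:E)%E.
Proof.
set kap := C ^+ 2 / c2_lo ^+ 2 * (M k.+1)%:R.
have kap0 : 0 <= kap by rewrite mulr_ge0 ?divr_ge0 ?sqr_ge0.
apply: integral_affine_le kap0 _ _ _ _ _ (sample_gap_int k) => //.
- exact: steps_measurable.
- by move=> w; exact: steps_ge0.
- by apply/measurable_EFinP; exact: sample_gap_meas.
- by move=> w; rewrite lee_fin sample_gap_ge0.
- apply: filterS (stop_ae k) => w [t + tle].
  rewrite /steps /ra_steps /stop => ->.
  by rewrite -EFinM -EFinD lee_fin.
Qed.

(** Almost surely the solver stops, so the sample gradient at the new iterate is
within the tolerance c2 / sqrt M. *)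
Lemma grad_ae c0 k : 0 < c0 -> {ae P, forall w,
  Num.sqrt (M k.+1)%:R * enorm (gf (X k.+1 w)) <= c2 + Num.sqrt (M k.+1)%:R *
    enorm (rel_err gf c0 (gfM k.+1 w) (X k.+1 w)) *
    (enorm (gf (X k.+1 w)) + c0)}.
Proof.
move=> c00; apply: filterS (stop_ae k) => w [t st _].
set z := enorm (gf (X k.+1 w)).
have s0 : 0 < Num.sqrt (M k.+1)%:R :> R by rewrite sqrtr_gt0 ltr0n.
have := enorm_le_rel_err gf (gfM k.+1 w) (X k.+1 w) c00; rewrite -/z => zle.
have : enorm (gfM k.+1 w (X k.+1 w)) <= eps k.+1 w.
  by rewrite iterS st; exact: first_time_Some st.
have [_ /(_ w) /andP[_ C2hi]] := C2P (ltn0Sn k).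
rewrite /eps ler_pdivlMr// => gle.
rewrite -mulrA; apply: le_trans (ler_wpM2l (ltW s0) zle) _.
by rewrite mulrDr lerD2r mulrC; exact: le_trans C2hi.
Qed.

Lemma mean_gap_ge0 x : 0 <= mean_gap x.
Proof.
rewrite -lee_fin -gap_int; apply: integral_ge0 => y _.
by rewrite lee_fin normr_ge0.
Qed.

Lemma gap_bound_ge0 : 0 <= gap_bound.
Proof.
rewrite -lee_fin; apply: le_trans (mean_gap_le 0).
by apply: integral_ge0 => w _; rewrite lee_fin mean_gap_ge0.
Qed.

(** * Total work and accuracy *)

Hypothesis c1_gt1 : 1 < c1.
Hypothesis MS : forall k, (2 <= k)%N -> (M k)%:R = c1 * (M k.-1)%:R.

Let Kwork := (1 + C ^+ 2 / c2_lo ^+ 2 * gap_bound) * (c1 ^+ 2 / (c1 ^+ 2 - 1)).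

(** Iteration j costs M_j oracle calls per step and makes on average at most a
constant times M_j steps. *)
Lemma work_int k : (\int[P]_w W k.+1 w <= (Kwork * (M k.+1)%:R ^+ 2)%:E)%E.
Proof.
pose kap := C ^+ 2 / c2_lo ^+ 2.
have kap0 : 0 <= kap by rewrite divr_ge0 ?sqr_ge0.
have -> : (\int[P]_w W k.+1 w =
    \sum_(0 <= j < k.+1) (M j.+1)%:R%:E * \int[P]_w steps j.+1 w)%E.
  transitivity
    (\int[P]_w \sum_(0 <= j < k.+1) ((M j.+1)%:R%:E * steps j.+1 w))%E.
    apply: eq_integral => w _; rewrite /W /ra_work big_add1 /=.
    by apply: eq_bigr => j _; rewrite muleC.
  rewrite ge0_integral_sum//; last 2 first.
  - by move=> j; apply: emeasurable_funM => //; exact: steps_measurable.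
  - by move=> j w _; rewrite mule_ge0 ?lee_fin// steps_ge0.
  apply: eq_bigr => j _; rewrite ge0_integralZl//.
  - exact: steps_measurable.
  - by move=> w _; exact: steps_ge0.
apply: (@le_trans _ _
  (\sum_(0 <= j < k.+1) ((1 + kap * gap_bound) * (M j.+1)%:R ^+ 2)%:E)%E).
  apply: lee_sum => j _.
  apply: (@le_trans _ _
    ((M j.+1)%:R%:E * (1 + kap * (M j.+1)%:R * gap_bound)%:E)%E).
    by rewrite lee_wpmul2l ?lee_fin// steps_int.
  rewrite -EFinM lee_fin.
  have M1 : 1 <= (M j.+1)%:R :> R by rewrite ler1n M_gt0.
  move: (M j.+1)%:R M1 => m m1.
  have m0 : 0 <= m - 1 by rewrite subr_ge0.
  by have := mulr_ge0 (le_trans ler01 m1) m0; lra.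
rewrite sumEFin lee_fin -mulr_sumr /Kwork -/kap -mulrA ler_wpM2l//.
  by rewrite addr_ge0// mulr_ge0// gap_bound_ge0.
by have := sum_sqr_sample_size c1_gt1 MS k; rewrite big_add1.
Qed.

Lemma complexity (B : R) : 0 < B ->
    (forall k, (\int[P]_w (Num.sqrt (M k.+1)%:R * enorm (gf (X k.+1 w)))%:E
       <= B%:E)%E) ->
  forall e : R, 0 < e -> (M 1)%:R <= (B / e) ^+ 2 ->
  exists k, [/\ (1 <= k)%N,
    ('E_P[fun w => enorm (gf (X k w))] <= e%:E)%E &
    (\int[P]_w W k w <= (Kwork * (c1 * (B / e) ^+ 2) ^+ 2)%:E)%E].
Proof.
move=> B0 HB e e0 Me.
have [k Mlo Mhi] := exists_sample_size (M_gt0 0) c1_gt1 MS Me.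
exists k.+1; split=> //.
- have Be : 0 < B / e by rewrite divr_gt0.
  have sBe : B / e <= Num.sqrt (M k.+1)%:R.
    by rewrite -(@ger0_norm _ (B / e)) ?(ltW Be)// -sqrtr_sqr ler_sqrt.
  have s0 : 0 < Num.sqrt (M k.+1)%:R :> R by exact: lt_le_trans sBe.
  rewrite unlock -(@lee_pmul2l _ (Num.sqrt (M k.+1)%:R)%:E) ?lte_fin//.
  rewrite -ge0_integralZl//; last 2 first.
  + by apply/measurable_EFinP; exact: gradient_iter_measurable.
  + by move=> w _; rewrite lee_fin enorm_ge0.
  under eq_integral do rewrite -EFinM.
  apply: le_trans (HB k) _; rewrite -EFinM lee_fin.
  by rewrite -ler_pdivrMr.
- apply: le_trans (work_int k) _; rewrite lee_fin ler_wpM2l//.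
    apply: mulr_ge0.
      by rewrite addr_ge0// mulr_ge0 ?gap_bound_ge0// divr_ge0 ?sqr_ge0.
    by rewrite divr_ge0 ?sqr_ge0// subr_ge0 exprn_ege1// ltW.
  by rewrite lerXn2r ?nnegrE// (le_trans _ Mhi).
Qed.

(** Case (I).  Young's inequality produces the squares of the relative error and
of the gradient norm, and both have means bounded by hypothesis. *)
Lemma gradient_bound_sqr (c0 sigma l : R) (k : nat) : 0 < c0 ->
    cond_exp_le P (Fk k)
      (fun w => ((Num.sqrt (M k.+1)%:R)%:E * sup_err gf c0 (gfM k.+1 w)) ^+ 2)%E
      (sigma ^+ 2) ->
    cond_exp_le P (Fk k) (fun w => (enorm (gf (X k.+1 w)) ^+ 2)%:E) (l ^+ 2) ->
  (\int[P]_w (Num.sqrt (M k.+1)%:R * enorm (gf (X k.+1 w)))%:E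
    <= (c2 + c0 ^+ 2 / 2 + 1 * (sigma ^+ 2 + l ^+ 2))%:E)%E.
Proof.
move=> c00 hU hz; have FT : Fk k setT.
  exact: (@measurableT _ (past_type Yt (nobs M k))).
have mF := @sigma_first_measurable _ _ _ _ _ _ _ _ Y_iid (nobs M k).
have [mU U0 intU] := cond_exp_le_integral FT mF (sqr_ge0 _) hU.
have [mz z0 intz] := cond_exp_le_integral FT mF (sqr_ge0 _) hz.
have c20 : 0 < c2.
  have [_ /(_ point) /andP[+ +]] := C2P (ltn0Sn 0).
  by move=> /(lt_le_trans c2_lo_gt0); exact: lt_le_trans.
have s0 : 0 <= Num.sqrt (M k.+1)%:R :> R by exact: sqrtr_ge0.
pose U w := (((Num.sqrt (M k.+1)%:R)%:E * sup_err gf c0 (gfM k.+1 w)) ^+ 2)%E.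
apply: (@integral_affine_le _ _ _ _ _
  (fun w => U w + (enorm (gf (X k.+1 w)) ^+ 2)%:E)%E).
- by rewrite addr_ge0 ?divr_ge0 ?sqr_ge0// ltW.
- by [].
- apply/measurable_EFinP; apply: measurable_funM => //.
  exact: gradient_iter_measurable.
- by move=> w; rewrite lee_fin mulr_ge0// enorm_ge0.
- exact: emeasurable_funD.
- by move=> w; apply: adde_ge0; [exact: U0|rewrite lee_fin sqr_ge0].
- apply: filterS (grad_ae k c00) => w /(young_bound_sqr s0).
  set z := enorm _; set rho := enorm _ => zle.
  rewrite mul1e; apply: (@le_trans _ _ ((c2 + c0 ^+ 2 / 2)%:E +
    (((Num.sqrt (M k.+1)%:R * rho) ^+ 2)%:E + (z ^+ 2)%:E))%E).
    rewrite -!EFinD lee_fin addrA; apply: le_trans zle _.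
    by rewrite lerD2l; have := sqr_ge0 z; lra.
  rewrite leeD2l// leeD2r// /U EFin_expe EFinM.
  rewrite !expe2.
  have rho0 : 0 <= rho by exact: enorm_ge0.
  have rle : (rho%:E <= sup_err gf c0 (gfM k.+1 w))%E.
    by apply: ereal_sup_ubound; exists (X k.+1 w).
  have srle : ((Num.sqrt (M k.+1)%:R)%:E * rho%:E <=
      (Num.sqrt (M k.+1)%:R)%:E * sup_err gf c0 (gfM k.+1 w))%E.
    by rewrite lee_wpmul2l ?lee_fin.
  by apply: lee_pmul => //; rewrite mule_ge0 ?lee_fin.
- have -> : (\int[P]_w (U w + (enorm (gf (X k.+1 w)) ^+ 2)%:E) =
      \int[P]_w U w + \int[P]_w (enorm (gf (X k.+1 w)) ^+ 2)%:E)%E.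
    by apply: ge0_integralD => // w _; exact: U0.
  rewrite [leRHS]EFinD; exact: leeD intU intz.
Qed.

(** Case (II).  No moment of the gradient norm is known beforehand: it has to be
absorbed pointwise, by [young_bound_pow]. *)
Lemma gradient_bound_pow (c0 alpha delta0 sigma0 : R) (k : nat) : 0 < c0 ->
    0 < alpha < 1 -> 0 < delta0 ->
    cond_exp_le P (Fk k)
      (fun w => ((Num.sqrt (M k.+1)%:R)%:E
         * sup_err_pow gf c0 alpha delta0 (gfM k.+1 w)) `^ alpha^-1)%E
      (sigma0 `^ alpha^-1) ->
  (\int[P]_w (Num.sqrt (M k.+1)%:R * enorm (gf (X k.+1 w)))%:E
    <= (2 * c2 + 2 * c0 / delta0 +
        (2 * c0 / delta0 + 2 `^ alpha^-1) * sigma0 `^ alpha^-1)%:E)%E.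
Proof.
move=> c00 a01 d0 hV; have FT : Fk k setT.
  exact: (@measurableT _ (past_type Yt (nobs M k))).
have mF := @sigma_first_measurable _ _ _ _ _ _ _ _ Y_iid (nobs M k).
have [mV V0 intV] := cond_exp_le_integral FT mF (powR_ge0 _ _) hV.
have c20 : 0 < c2.
  have [_ /(_ point) /andP[+ +]] := C2P (ltn0Sn 0).
  by move=> /(lt_le_trans c2_lo_gt0); exact: lt_le_trans.
have s1 : 1 <= Num.sqrt (M k.+1)%:R :> R.
  by rewrite -[leLHS]sqrtr1 ler_sqrt ?ler1n ?ler0n.
have s0 : 0 <= Num.sqrt (M k.+1)%:R :> R by exact: sqrtr_ge0.
have cd0 : 0 <= 2 * c0 / delta0.
  by rewrite divr_ge0 ?mulr_ge0 ?(ltW c00) ?(ltW d0).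
apply: integral_affine_le intV => //.
- by rewrite addr_ge0// mulr_ge0// ltW.
- by rewrite addr_ge0// powR_ge0.
- apply/measurable_EFinP; apply: measurable_funM => //.
  exact: gradient_iter_measurable.
- by move=> w; rewrite lee_fin mulr_ge0// enorm_ge0.
- apply: filterS (grad_ae k c00) => w.
  move=> /(young_bound_pow a01 d0 s1 (enorm_ge0 _) (enorm_ge0 _) (ltW c00)
    (ltW c20)).
  set z := enorm (gf _); set rho := enorm _ => zle.
  have rho0 : 0 <= rho by exact: enorm_ge0.
  apply: (@le_trans _ _ (2 * c2 + 2 * c0 / delta0 +
    (2 * c0 / delta0 + 2 `^ alpha^-1) *
    (Num.sqrt (M k.+1)%:R * (rho * (z `^ alpha + delta0))) `^ alpha^-1)%:E).
    by rewrite lee_fin.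
  rewrite EFinD leeD2l// EFinM lee_wpmul2l//.
    by rewrite lee_fin addr_ge0// powR_ge0.
  have q0 : 0 <= rho * (z `^ alpha + delta0).
    by rewrite mulr_ge0// addr_ge0 ?powR_ge0// ltW.
  have hle : ((rho * (z `^ alpha + delta0))%:E <=
      sup_err_pow gf c0 alpha delta0 (gfM k.+1 w))%E.
    by apply: ereal_sup_ubound; exists (X k.+1 w).
  rewrite -poweR_EFin; apply: gt0_ler_poweR.
  + by case/andP: a01 => a0 _; rewrite invr_ge0 ltW.
  + by rewrite in_itv /= leey andbT lee_fin mulr_ge0.
  + rewrite in_itv /= leey andbT mule_ge0 ?lee_fin//.
    by apply: le_trans hle; rewrite lee_fin.
  + by rewrite EFinM lee_wpmul2l ?lee_fin.
Qed.

End retrospective_approximation.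

Theorem theorem6 (R : realType) (d : nat)
  (dO dY : measure_display)
  (Omega : measurableType dO) (P : probability Omega R)
  (Y : measurableType dY) (mu : probability Y R)
  (F : 'rV[R]_d -> Y -> R)
  (Yt : nat -> Omega -> Y)
  (S : solver_type R d) (x0 : 'rV[R]_d)
  (M : nat -> nat) (m1 : nat)
  (C2 CM : nat -> Omega -> R)
  (c0 c1 c2_lo c2 C CA sigma A : R) :
  let f := objective mu F in
  let gf := grad f in
  let Fk k := sigma_first Yt (nobs M k) in
  let eps k w := C2 k w / Num.sqrt (M k)%:R in
  let X k w := ra_iter F S M (eps^~ w) x0 (Yt^~ w) k in
  let Xin k t w := ra_inner F S M (Yt^~ w) k (X k.-1 w) t in
  let W k w := ra_work F S M (eps^~ w) x0 (Yt^~ w) k in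
  let fM k w := sample_fun F (M k) (batch M (Yt^~ w) k) in
  let gfM k w := sample_grad F (M k) (batch M (Yt^~ w) k) in
  (forall y, smooth (F^~ y)) ->
  (forall x, mu.-integrable setT (fun y => (F x y)%:E)) ->
  (forall x, differentiable f x) ->
  (forall x i, mu.-integrable setT (fun y => (grad (F^~ y) x ord0 i)%:E) /\
     (\int[mu]_y (grad (F^~ y) x ord0 i)%:E = (gf x ord0 i)%:E)%E) ->
  iid P mu Yt ->
  (0 < m1)%N -> M 1%N = m1 ->
  1 < c1 ->
  (forall k, (2 <= k)%N -> (M k)%:R = c1 * (M k.-1)%:R) ->
  0 < c2_lo -> c2_lo <= c2 ->
  (forall k, (1 <= k)%N -> measurable_wrt (Fk k.-1) (C2 k) /\
     forall w, c2_lo <= C2 k w <= c2) ->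
  (forall k h x, S k h x 0%N = x) ->
  (forall k t i, (1 <= k)%N ->
     measurable_wrt (Fk k) (fun w => Xin k t w ord0 i)) ->
  (forall k, (1 <= k)%N -> {ae P, forall w,
     0 < CM k w <= C /\
     sublinear_half (fM k w) (gfM k w) (fun t => Xin k t w) (CM k w)}) ->
  (ereal_sup [set 'E_P[fun w => f (X k w)] | k in [set k | (1 <= k)%N]]
     < (CA / 2)%:E)%E ->
  ((- (CA / 2))%:E
     < \int[mu]_y ereal_inf (range (fun x => (F x y)%:E)))%E ->
  0 < c0 -> 0 <= sigma ->
  (forall k, (1 <= k)%N ->
     cond_exp_le P (Fk k.-1)
       (fun w => ((Num.sqrt (M k)%:R)%:E * sup_err gf c0 (gfM k w)) ^+ 2)%E
       (sigma ^+ 2)) ->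
  (exists l : R,
     [/\ 0 <= l,
         {ae P, forall w,
            (fun m => sup_err gf c0 (sample_grad F m (Yt^~ w))) @ \oo --> 0%E},
         (\int[mu]_y (sup_err gf c0 (grad (F^~ y)) ^+ 2) < +oo)%E,
         forall k, (1 <= k)%N ->
           cond_exp_le P (Fk k.-1)
             (fun w => (enorm (gf (X k w)) ^+ 2)%:E) (l ^+ 2)
       & A = Num.sqrt c1 * (c2 + c0 * sigma + sigma * l) / Num.sqrt m1%:R])
  \/
  (exists alpha delta0 sigma0 : R,
     [/\ 0 < alpha < 1, 0 < delta0, 0 <= sigma0,
         forall k, (1 <= k)%N ->
           cond_exp_le P (Fk k.-1)
             (fun w => ((Num.sqrt (M k)%:R)%:E
                * sup_err_pow gf c0 alpha delta0 (gfM k w)) `^ alpha^-1)%E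
             (sigma0 `^ alpha^-1)
       & let kappa2 := 2 * (1 - alpha)
           * (2 * alpha / (1 - alpha)) `^ alpha * sigma0 in
         A = Num.sqrt c1 * (2 * (c2 + c0 * sigma0 / delta0)
                              / Num.sqrt m1%:R)
             + (kappa2 / Num.sqrt m1%:R) `^ alpha^-1]) ->
  exists K e0 : R, 0 < e0 /\
    forall e : R, 0 < e < e0 ->
      exists k : nat,
        [/\ (1 <= k)%N,
            ('E_P[fun w => enorm (gf (X k w))] <= e%:E)%E
          & (\int[P]_w W k w
               <= (K * (A ^+ 4 * m1%:R * C * CA
                     / ((c1 ^+ 2 - 1) * c2_lo ^+ 2 * e ^+ 4)))%:E)%E].
Proof.
move=> f gf Fk eps X Xin W fM gfM F_smooth F_int f_diff gradF Y_iid m1_gt0 M1.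
move=> c1_gt1 MS c2_lo_gt0 c2_lo_le C2P S0 Xin_meas sublin supf infF.
move=> c0_gt0 sigma_ge0 condG cases.
have M1_gt0 : (0 < M 1)%N by rewrite M1.
have M_gt0 := sample_size_gt0 M1_gt0 c1_gt1 MS.
have gradF_int x i := (gradF x i).1.
have cF y : continuous (F^~ y).
  by move=> x; exact/differentiable_continuous/(F_smooth y).1.
have [J [J_meas J_int J_le J_mean]] :=
  real_lower_envelope cF F_int (le_lt_trans (leNye _) infF).
set j0 := Rintegral mu setT J.
have j0E : (\int[mu]_y (J y)%:E = j0%:E)%E.
  by rewrite fineK//; exact: integrable_fin_num J_int.
have j0_gt : - (CA / 2) < j0 by rewrite -lte_fin -j0E J_mean.
have gap_ge0 x : 0 <= f x - j0 := mean_gap_ge0 F_int J_int J_le x.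
have mfX k : measurable_fun setT (f \o X k).
  exact: (objective_iter_measurable F_smooth f_diff gradF_int Y_iid C2P S0
    Xin_meas).
have fX_lt k : (1 <= k)%N -> (\int[P]_w (f (X k w))%:E < (CA / 2)%:E)%E.
  move=> k1; apply: le_lt_trans supf; apply: ereal_sup_ubound.
  by exists k => //; rewrite unlock.
have gap_iter k : (1 <= k)%N ->
    (\int[P]_w (f (X k w) - j0)%:E <= (CA / 2 - j0)%:E)%E.
  move=> k1.
  have ifX : P.-integrable setT (EFin \o (f \o X k)).
    apply: (@integrable_ge_cst _ _ _ _ _ j0) => //.
      by move=> w; rewrite -subr_ge0; exact: gap_ge0.
    exact: lt_trans (fX_lt k k1) (ltry _).
  under eq_integral do rewrite EFinB.
  rewrite integralB//; last exact: finite_measure_integrable_cst.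
  by rewrite integral_cst_probability EFinB leeB// ltW// fX_lt.
(* the bound on E f (X k) starts at k = 1; the start x0 enters separately *)
pose gap_bound := Num.max (f x0 - j0) (CA / 2 - j0).
have gap_le k : (\int[P]_w (f (X k w) - j0)%:E <= gap_bound%:E)%E.
  case: k => [|k].
    have -> : (\int[P]_w (f (X 0%N w) - j0)%:E = (f x0 - j0)%:E)%E.
      exact: (integral_cst_probability P (f x0 - j0)).
    by rewrite lee_fin le_max lexx.
  by apply: le_trans (gap_iter k.+1 isT) _; rewrite lee_fin le_max lexx orbT.
have CA_gt0 : 0 < CA.
  have : (0 <= (CA / 2 - j0)%:E)%E.
    apply: le_trans (gap_iter 1%N isT).
    by apply: integral_ge0 => w _; rewrite lee_fin.
  by rewrite lee_fin; lra.
have C_gt0 : 0 < C.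
  have P1 : (0 < P [set: Omega])%E by rewrite probability_setT.
  have PF := @ae_properfilter_algebraOfSetsType _ Omega R P P1.
  have [w [/andP[c00 cC] _]] := @filter_ex _ _ PF _ (sublin 1%N isT).
  exact: lt_le_trans cC.
have c2_gt0 : 0 < c2 by exact: lt_le_trans c2_lo_le.
have m1_pos : 0 < Num.sqrt m1%:R :> R by rewrite sqrtr_gt0 ltr0n.
have sc1_gt0 : 0 < Num.sqrt c1 by rewrite sqrtr_gt0 (lt_trans _ c1_gt1).
have [A_gt0 [B B_gt0 HB]] : 0 < A /\ exists2 B, 0 < B & forall k,
    (\int[P]_w (Num.sqrt (M k.+1)%:R * enorm (gf (X k.+1 w)))%:E <= B%:E)%E.
  have [[l [l_ge0 _ _ condz ->]] | [alpha [delta0 [sigma0]]]] := cases.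
    split.
      rewrite divr_gt0// mulr_gt0// -addrA ltr_pwDl// addr_ge0// mulr_ge0//.
      exact: ltW.
    exists (c2 + c0 ^+ 2 / 2 + 1 * (sigma ^+ 2 + l ^+ 2)).
      rewrite mul1r -addrA ltr_pwDl// !addr_ge0 ?divr_ge0 ?sqr_ge0//.
    move=> k; apply: (gradient_bound_sqr F_smooth f_diff gradF_int Y_iid M_gt0
      C2P c2_lo_gt0 S0 Xin_meas sublin J_le c0_gt0).
      exact: (condG k.+1).
    exact: (condz k.+1).
  move=> [alpha01 delta0_gt0 sigma0_ge0 condH ->]; split.
    rewrite ltr_pwDl ?powR_ge0// mulr_gt0// divr_gt0// mulr_gt0//.
    by rewrite ltr_pwDl// divr_ge0 ?(ltW delta0_gt0)// mulr_ge0// ltW.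
  have cd_ge0 : 0 <= 2 * c0 / delta0.
    by rewrite divr_ge0 ?(ltW delta0_gt0)// mulr_ge0// ltW.
  exists (2 * c2 + 2 * c0 / delta0 +
      (2 * c0 / delta0 + 2 `^ alpha^-1) * sigma0 `^ alpha^-1).
    rewrite -addrA ltr_pwDl ?mulr_gt0// addr_ge0// mulr_ge0 ?powR_ge0//.
    by rewrite addr_ge0// powR_ge0.
  move=> k; apply: (gradient_bound_pow F_smooth f_diff gradF_int Y_iid M_gt0
    C2P c2_lo_gt0 S0 Xin_meas sublin J_le c0_gt0 alpha01 delta0_gt0).
  exact: (condH k.+1).
pose Kwork := (1 + C ^+ 2 / c2_lo ^+ 2 * gap_bound) * (c1 ^+ 2 / (c1 ^+ 2 - 1)).
have c1s_gt0 : 0 < c1 ^+ 2 - 1 by rewrite subr_gt0 exprn_egt1.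
(* below B / sqrt m1, the target (B / e) ^ 2 exceeds the first sample size *)
exists (Kwork * (c1 * B ^+ 2) ^+ 2 *
  ((c1 ^+ 2 - 1) * c2_lo ^+ 2 / (A ^+ 4 * m1%:R * C * CA))),
  (B / Num.sqrt m1%:R); split; first by rewrite divr_gt0.
move=> e /andP[e_gt0 eB].
have Me : (M 1)%:R <= (B / e) ^+ 2.
  rewrite M1 -[leLHS]sqr_sqrtr ?ler0n// lerXn2r ?nnegrE ?(ltW m1_pos)//.
    by rewrite divr_ge0 ?(ltW B_gt0) ?(ltW e_gt0).
  by rewrite ler_pdivlMr// mulrC -ler_pdivlMr// ltW.
have [k [k1 zk Wk]] := complexity F_smooth F_int f_diff gradF_int Y_iid M_gt0
  C2P c2_lo_gt0 S0 Xin_meas sublin J_meas J_int J_le gap_le c1_gt1 MS B_gt0 HB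
  e_gt0 Me.
exists k; split=> //; apply: le_trans Wk _.
rewrite lee_fin le_eqVlt; apply/orP; left; apply/eqP; rewrite -/Kwork.
field.
by rewrite !gt_eqF ?ltr0n.
Qed.
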